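(* Let $n\ge4$. For every antichain $A$ of the root poset $\Phi^+(D_n)$, we have $\#A+\#\operatorname{Rvac}(A)=n$.
   Context: $\Phi^+(D_n)$ is the set $\{e_i\pm e_j:1\le i<j\le n\}$ with simple roots $\alpha_i=e_i-e_{i+1}$ ($1\le i\le n-1$), $\alpha_n=e_{n-1}+e_n$, ordered by $\alpha\le\beta$ iff $\beta-\alpha$ is a nonnegative integer combination of simple roots, and ranked by $\mathrm{rk}(\alpha)=\mathrm{height}(\alpha)-1$. For a finite ranked poset with rank sets $P_i$, the toggle $\tau_p$ on antichains removes $p$ if present, adds $p$ if the result is an antichain, and otherwise does nothing; $\boldsymbol{\tau}_i$ is the composite of the commuting toggles $\tau_p$ over $p\in P_i$; with $R$ the maximal rank and composition right to left, rowvacuation is $\operatorname{Rvac}=(\boldsymbol{\tau}_R)(\boldsymbol{\tau}_R\boldsymbol{\tau}_{R-1})\cdots(\boldsymbol{\tau}_R\cdots\boldsymbol{\tau}_1)(\boldsymbol{\tau}_R\cdots\boldsymbol{\tau}_0)$. *)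

(* Defs.v *)
From HB Require Import structures.
From mathcomp Require Import all_boot all_order all_algebra.
From mathcomp Require Import boolp.

Set Implicit Arguments.
Unset Strict Implicit.
Unset Printing Implicit Defensive.

Import Order.TTheory GRing.Theory Num.Theory.

Section RankedPoset.
Variables (d : Order.disp_t) (T : finPOrderType d) (rk : T -> nat).
Implicit Types (p : T) (A : {set T}) (i : nat).

Definition antichain A : bool :=
  [forall x in A, forall y in A, (x <= y)%O ==> (x == y)].

Definition toggle p A : {set T} :=
  if p \in A then A :\ p
  else if antichain (p |: A) then p |: A else A.

(* Toggles at distinct elements of the same rank commute on antichains, so the
   enumeration order is immaterial. *)
Definition rank_toggle i A : {set T} :=
  foldr toggle A (enum [pred p | rk p == i]).

Definition max_rank : nat := \max_(p : T) rk p.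

(* tau_R o ... o tau_(i+1) o tau_i, with R = max_rank; foldl applies tau_i
   first. *)
Definition rank_toggles_from i A : {set T} :=
  foldl (fun B j => rank_toggle j B) A (iota i (max_rank.+1 - i)).

(* (tau_R) o (tau_R o tau_(R-1)) o ... o (tau_R o ... o tau_0); the rightmost
   block, with i = 0, is applied first. *)
Definition Rvac A : {set T} :=
  foldl (fun B i => rank_toggles_from i B) A (iota 0 max_rank.+1).

End RankedPoset.

Section RootPosetD.
Local Open Scope ring_scope.

(* Coordinates are numbered 0, ..., n-1. *)
Definition evec (n k : nat) : 'rV[int]_n := \row_j (val j == k)%:R.

Definition simpleD (n : nat) (k : 'I_n) : 'rV[int]_n :=
  if (k.+1 < n)%N then evec n k - evec n k.+1 else evec n n.-2 + evec n n.-1.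

Definition posrootsD (n : nat) : seq 'rV[int]_n :=
  [seq evec n p.1 - evec n p.2 | p : 'I_n * 'I_n <- enum {: 'I_n * 'I_n} & (p.1 < p.2)%N] ++
  [seq evec n p.1 + evec n p.2 | p : 'I_n * 'I_n <- enum {: 'I_n * 'I_n} & (p.1 < p.2)%N].

Definition PhiD (n : nat) : Type := seq_sub (posrootsD n).
HB.instance Definition _ (n : nat) := Finite.on (PhiD n).

Definition simple_comb (n : nat) (c : 'I_n -> nat) : 'rV[int]_n :=
  \sum_(k < n) simpleD k *+ c k.

Definition leD (n : nat) : rel (PhiD n) := fun a b =>
  `[< exists c : 'I_n -> nat, ssval b - ssval a = simple_comb c >].

Lemma posrootsDP (n : nat) (v : 'rV[int]_n) :
  reflect (exists i j : 'I_n, (i < j)%N /\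
             (v = evec n i - evec n j \/ v = evec n i + evec n j))
          (v \in posrootsD n).
Proof.
rewrite mem_cat; apply: (iffP orP).
- by case=> /mapP[[i j]]; rewrite mem_filter /= => /andP[ij _] ->;
    exists i, j; split=> //; [left | right].
- case=> i [j [ij [->|->]]]; [left | right]; apply/mapP; exists (i, j) => //;
  by rewrite mem_filter /= ij mem_enum.
Qed.

Lemma simple_combD (n : nat) (c c' : 'I_n -> nat) :
  simple_comb c + simple_comb c' = simple_comb (fun k => c k + c' k)%N.
Proof. by rewrite -big_split; apply: eq_bigr => k _; rewrite mulrnDr. Qed.

(* Pairing with the half-sum (n-1, ..., 1, 0) of the positive roots. *)
Definition rho_pair (n : nat) (v : 'rV[int]_n) : int :=
  \sum_(j < n) v ord0 j * (n.-1 - j)%N%:R.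

Lemma rho_pairD (n : nat) (u v : 'rV[int]_n) :
  rho_pair (u + v) = rho_pair u + rho_pair v.
Proof. by rewrite -big_split; apply: eq_bigr => j _; rewrite mxE mulrDl. Qed.

Lemma rho_pair0 (n : nat) : rho_pair (0 : 'rV[int]_n) = 0.
Proof. by rewrite /rho_pair big1 // => j _; rewrite mxE mul0r. Qed.

Lemma rho_pairN (n : nat) (u : 'rV[int]_n) : rho_pair (- u) = - rho_pair u.
Proof. by rewrite -sumrN; apply: eq_bigr => j _; rewrite mxE mulNr. Qed.

Lemma rho_pairMn (n m : nat) (u : 'rV[int]_n) :
  rho_pair (u *+ m) = rho_pair u *+ m.
Proof.
by elim: m => [|m IH]; rewrite ?mulr0n ?rho_pair0 // !mulrS rho_pairD IH.
Qed.

Lemma rho_pair_evec (n k : nat) :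
  (k < n)%N -> rho_pair (evec n k) = (n.-1 - k)%N%:R.
Proof.
move=> kn; rewrite /rho_pair (bigD1 (Ordinal kn)) //= mxE eqxx mul1r big1.
  by rewrite addr0.
by move=> j; rewrite -val_eqE /= mxE => /negbTE ->; rewrite mul0r.
Qed.

Lemma rho_pair_simple (n : nat) (k : 'I_n) :
  (1 < n)%N -> rho_pair (simpleD k) = 1.
Proof.
case: n k => [|[|n]] // k _; rewrite /simpleD; case: ifP => [kn|_].
  rewrite rho_pairD rho_pairN !rho_pair_evec //= subSS subSn //.
  by rewrite -natr1 addrAC subrr add0r.
by rewrite rho_pairD !rho_pair_evec //= subnn addr0 subSn // subnn.
Qed.

Lemma rho_pair_comb (n : nat) (c : 'I_n -> nat) :
  (1 < n)%N -> rho_pair (simple_comb c) = (\sum_k c k)%N%:R.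
Proof.
move=> n1; rewrite /simple_comb natr_sum.
rewrite (big_morph _ (@rho_pairD n) (@rho_pair0 n)).
by apply: eq_bigr => k _; rewrite rho_pairMn rho_pair_simple.
Qed.

Lemma PhiD_gt1 (n : nat) (a : PhiD n) : (1 < n)%N.
Proof.
have /posrootsDP[i [j [ij _]]] := ssvalP a.
exact: leq_ltn_trans (leq_ltn_trans (leq0n i) ij) (ltn_ord j).
Qed.

Lemma leD_refl (n : nat) : reflexive (@leD n).
Proof.
move=> a; apply/asboolP; exists (fun _ => 0%N).
by rewrite subrr /simple_comb big1 // => k _; rewrite mulr0n.
Qed.

Lemma leD_anti (n : nat) : antisymmetric (@leD n).
Proof.
move=> a b /andP[/asboolP[c Hc] /asboolP[c' Hc']]; apply/val_inj => /=.
have := congr1 (@rho_pair n) (simple_combD c c').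
rewrite -Hc -Hc' addrA subrK subrr rho_pair0 rho_pair_comb ?(PhiD_gt1 a) //.
move/esym/eqP; rewrite pnatr_eq0 sum_nat_eq0 => /forallP c0.
move/eqP: Hc; rewrite /simple_comb big1 ?subr_eq0 => [/eqP-> //|k _].
by have := c0 k; rewrite /= addn_eq0 => /andP[/eqP-> _].
Qed.

Lemma leD_trans (n : nat) : transitive (@leD n).
Proof.
move=> b a c /asboolP[x Hx] /asboolP[y Hy]; apply/asboolP.
exists (fun k => x k + y k)%N.
by rewrite -simple_combD -Hx -Hy [RHS]addrC subrKA.
Qed.

Fact PhiD_display : Order.disp_t. Proof. exact: Order.Disp tt tt. Qed.

HB.instance Definition _ (n : nat) :=
  Order.Le_isPOrder.Build PhiD_display (PhiD n)
    (@leD_refl n) (@leD_anti n) (@leD_trans n).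

Lemma evecB_comb (n m i : nat) : (i + m < n)%N ->
  exists c : 'I_n -> nat, evec n i - evec n (i + m)%N = simple_comb c.
Proof.
elim: m => [|m IH] imn.
  exists (fun _ => 0%N).
  by rewrite addn0 subrr /simple_comb big1 // => k _; rewrite mulr0n.
have im : (i + m < n)%N by apply: leq_trans imn; rewrite addnS.
have [c Hc] := IH im; exists (fun k => c k + (val k == (i + m)%N))%N.
rewrite -simple_combD -Hc -(subrKA (evec n (i + m)%N)); congr (_ + _).
rewrite /simple_comb (bigD1 (Ordinal im)) //= eqxx mulr1n big1 => [|k].
  by rewrite addr0 /simpleD /= -addnS imn.
by rewrite -val_eqE /= => /negbTE ->; rewrite mulr0n.
Qed.

Lemma PhiD_comb (n : nat) (a : PhiD n) :
  exists c : 'I_n -> nat, ssval a = simple_comb c.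
Proof.
have n1 := PhiD_gt1 a; have /posrootsDP[i [j [ij Hv]]] := ssvalP a.
have sub (k l : nat) : (k <= l < n)%N ->
    exists c : 'I_n -> nat, evec n k - evec n l = simple_comb c.
  by case/andP=> kl ln; rewrite -(subnKC kl); apply: evecB_comb; rewrite subnKC.
case: Hv => ->; first by apply: sub; rewrite (ltnW ij) /=.
have n'n : (n.-1 < n)%N by rewrite prednK // ltnW.
have jn' : (j <= n.-1)%N by rewrite -ltnS prednK // ltnW.
have in' : (i <= n.-2)%N.
  by rewrite -ltnS prednK ?(leq_trans ij) // -ltnS prednK // ltnW.
have n''n : (n.-2 < n)%N := leq_ltn_trans (leq_pred _) n'n.
have [c1 H1] := sub i n.-2 (introT andP (conj in' n''n)).
have [c2 H2] := sub j n.-1 (introT andP (conj jn' n'n)).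
have [c3 H3] : exists c : 'I_n -> nat,
    evec n n.-2 + evec n n.-1 = simple_comb c.
  exists (fun k => (val k == n.-1) : nat).
  rewrite /simple_comb (bigD1 (Ordinal n'n)) //= eqxx mulr1n big1 => [|k].
    by rewrite addr0 /simpleD /= prednK ?ltnn // ltnW.
  by rewrite -val_eqE /= => /negbTE ->; rewrite mulr0n.
exists (fun k => c1 k + c2 k + c3 k)%N.
by rewrite -!simple_combD -H1 -H2 -H3 [RHS]addrACA !subrK.
Qed.

Definition coefD (n : nat) (a : PhiD n) : 'I_n -> nat :=
  sval (cid (PhiD_comb a)).

Definition heightD (n : nat) (a : PhiD n) : nat := (\sum_(k < n) coefD a k)%N.

(* The height does not depend on the decomposition selected by cid. *)
Lemma heightDE (n : nat) (a : PhiD n) (c : 'I_n -> nat) :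
  ssval a = simple_comb c -> heightD a = (\sum_(k < n) c k)%N.
Proof.
move=> Hc; have n1 := PhiD_gt1 a.
have Ha : ssval a = simple_comb (coefD a) := svalP (cid (PhiD_comb a)).
have := congr1 (@rho_pair n) (etrans (esym Ha) Hc).
by rewrite !rho_pair_comb // => /eqP; rewrite eqr_nat => /eqP.
Qed.

Definition rkD (n : nat) (a : PhiD n) : nat := (heightD a).-1.

End RootPosetD.

(* Main.v *)
Require Import Defs.
From mathcomp Require Import all_boot all_order all_algebra.
From mathcomp Require Import boolp zify ring.

(* The [r]-th block [tau_R o ... o tau_r] of rowvacuation sends an antichain X to
   the minimal elements of the complement of a down-set z, which is the
   complement of the filter generated by X in ranks < r, and the ideal generated
   by X in ranks >= r. The number
     #{x in X : rk x < r} + #{q of rank r : everything below q is in z}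
       - #{x in X : rk x >= r}
   starts at n - #A, ends at #Rvac(A), and would be preserved by every block in
   type A. In type D it is preserved after two corrections: for r odd, add the
   number of roots e_i + e_{i+1} among the elements of X of rank >= r; and if z is
   stable under e_n <-> -e_n, add 1 if those elements include some e_i + e_n,
   and subtract 1 if they include a root of a certain hook (see [hook]).

   Draw e_i - e_j in row i and column j, and e_i + e_j in row i and column 2n - j,
   so that only column n is doubled. If t(c) is the topmost row of z in column c,
   then column c contains a maximal element of z, and column c + 1 a minimal
   element of the complement, essentially when t(c) < t(c + 1); preservation is
   then a telescoping sum over columns, with boundary terms at rank r and on the
   diagonal. If z is not stable under e_n <-> -e_n, which persists from block to
   block, it splits along column n into two halves that balance separately. *)

Set Implicit Arguments.
Unset Strict Implicit.
Unset Printing Implicit Defensive.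

Import Order.TTheory.

(** * Blocks of rowvacuation as down-set operators *)

Section RowvacuationBlocks.
Variables (d : Order.disp_t) (T : finPOrderType d) (rk : T -> nat).
Hypothesis rk_lt : forall p q : T, (p < q)%O -> rk p < rk q.
Implicit Types (p q x : T) (X Y z : {set T}) (r : nat).

Definition min_compl z : {set T} :=
  [set q | (q \notin z) && [forall p, (p < q)%O ==> (p \in z)]].

Definition max_above r z : {set T} :=
  [set q in z | (r <= rk q) && [forall p, (q < p)%O ==> (p \notin z)]].

Definition from_rank r X : {set T} := [set q in X | r <= rk q].

Definition downset z : Prop := forall p q, (p <= q)%O -> q \in z -> p \in z.

(* The antichain [X] reached before the block [tau_R o ... o tau_r]: its
   elements of rank [< r] are the minimal elements outside this set, and those
   of rank [>= r] are maximal elements of it. *)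
Definition block_ideal r X : {set T} :=
  [set q | if rk q < r then ~~ [exists x in X, (x <= q)%O]
           else [exists x in X, (q <= x)%O]].

Lemma rk_le p q : (p <= q)%O -> rk p <= rk q.
Proof. by rewrite le_eqVlt => /orP[/eqP->|/rk_lt/ltnW]. Qed.

Lemma antichainP X :
  reflect {in X &, forall x y, (x <= y)%O -> x = y} (antichain X).
Proof.
apply: (iffP 'forall_in_'forall_in_implyP) => [H x y xX yX xy|H x xX y yX xy].
  by apply/eqP/H.
by apply/eqP/H.
Qed.

Lemma min_complP z q :
  reflect (q \notin z /\ forall p, (p < q)%O -> p \in z) (q \in min_compl z).
Proof.
rewrite inE; apply: (iffP andP) => -[qz H]; split=> //.
  by move=> p pq; move/forallP/(_ p)/implyP: H; apply.
by apply/forallP=> p; apply/implyP/H.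
Qed.

Lemma max_aboveP r z q :
  reflect [/\ q \in z, r <= rk q & forall p, (q < p)%O -> p \notin z]
          (q \in max_above r z).
Proof.
rewrite inE; apply: (iffP and3P) => -[qz rq H]; split=> //.
  by move=> p pq; move/forallP/(_ p)/implyP: H; apply.
by apply/forallP=> p; apply/implyP/H.
Qed.

Lemma min_compl_ex z q : q \notin z -> exists2 p, p \in min_compl z & (p <= q)%O.
Proof.
have [m] := ubnP (rk q); elim: m q => // m IH q qm qz.
have [/existsP[p /andP[pq pz]]|/existsPn H] :=
  boolP [exists p, (p < q)%O && (p \notin z)].
  have [|p' p'M p'p] := IH p _ pz.
    by apply: leq_trans (rk_lt pq) _; rewrite -ltnS.
  by exists p' => //; apply: le_trans p'p (ltW pq).
exists q => //; apply/min_complP; split=> // p pq.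
by have := H p; rewrite pq /= negbK.
Qed.

Lemma min_compl_antichain z : antichain (min_compl z).
Proof.
apply/antichainP=> x y /min_complP[xz _] /min_complP[_ Hy].
rewrite le_eqVlt => /orP[/eqP//|/Hy xz'].
by rewrite xz' in xz.
Qed.

(** The two halves fit at rank [r]: an element of [X] below [p] and one above [q] would be
    comparable, hence equal, yet of rank both [< r] and [>= r]. *)
Lemma block_ideal_down r X : antichain X -> downset (block_ideal r X).
Proof.
move/antichainP=> aX p q pq; rewrite !inE.
have := rk_le pq; case: (ltnP (rk p) r) => pr; case: (ltnP (rk q) r) => qr rpq.
- move=> H; apply: contra H => /exists_inP[x xX xp]; apply/exists_inP.
  by exists x => //; apply: le_trans xp pq.
- case/exists_inP=> x xX qx; apply/negP=> /exists_inP[y yX yp].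
  have yx : y = x by apply: aX => //; apply: le_trans yp (le_trans pq qx).
  have := rk_le qx; have := rk_le yp; rewrite yx; lia.
- lia.
- case/exists_inP=> x xX qx; apply/exists_inP; exists x => //.
  exact: le_trans pq qx.
Qed.

Lemma min_compl_block_low r X q : antichain X -> rk q < r ->
  (q \in min_compl (block_ideal r X)) = (q \in X).
Proof.
move=> /antichainP aX qr; apply/min_complP/idP.
  case; rewrite inE qr negbK => /exists_inP[x xX].
  rewrite le_eqVlt => /orP[/eqP<-//|xq] /(_ x xq).
  rewrite inE (ltn_trans (rk_lt xq) qr) => /negP[].
  by apply/exists_inP; exists x.
move=> qX; split; first by rewrite inE qr negbK; apply/exists_inP; exists q.
move=> p pq; rewrite inE (ltn_trans (rk_lt pq) qr).
apply/negP=> /exists_inP[x xX xp].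
have xq : x = q by apply: aX => //; apply: le_trans xp (ltW pq).
by move: pq; rewrite -xq => /lt_geF; rewrite xp.
Qed.

Lemma from_rank_block r X : antichain X ->
  from_rank r X = max_above r (block_ideal r X).
Proof.
move=> /antichainP aX; apply/setP=> q; rewrite inE; apply/andP/max_aboveP.
  case=> qX rq; split=> //.
    by rewrite inE ltnNge rq /=; apply/exists_inP; exists q.
  move=> p qp; rewrite inE ltnNge (leq_trans rq (ltnW (rk_lt qp))) /=.
  apply/negP=> /exists_inP[x xX px].
  have xq : q = x by apply: aX => //; apply: le_trans (ltW qp) px.
  by move: qp; rewrite xq => /lt_geF; rewrite px.
case; rewrite inE => + rq; rewrite ltnNge rq /= => /exists_inP[x xX].
rewrite le_eqVlt => /orP[/eqP->//|qx] /(_ x qx).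
rewrite inE ltnNge (leq_trans rq (ltnW (rk_lt qx))) /= => /negP[].
by apply/exists_inP; exists x.
Qed.

Lemma toggle_antichain p X : antichain X -> antichain (toggle p X).
Proof.
rewrite /toggle => aX; case: ifP => // _; last by case: ifP.
by apply/antichainP=> x y /setD1P[_ xX] /setD1P[_ yX]; apply: (antichainP _ aX).
Qed.

Definition comparable_in X q : bool :=
  [exists x in X, (x <= q)%O || (q <= x)%O].

Lemma comparable_inP X q :
  reflect (exists2 x, x \in X & (x <= q)%O || (q <= x)%O) (comparable_in X q).
Proof. exact: exists_inP. Qed.

(** [comparable_in X q] holds in particular for [q] in [X], so a toggle leaves [p] present exactly
    when [p] was comparable to nothing. Distinct elements of one rank are incomparable, so the other
    toggles of the list do not affect this test. *)
Lemma foldr_toggle (i : nat) X (s : seq T) : antichain X -> uniq s ->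
  all (fun p => rk p == i) s ->
  antichain (foldr (@toggle d T) X s) /\
  foldr (@toggle d T) X s =
    [set q | if q \in s then ~~ comparable_in X q else q \in X].
Proof.
move=> aX; elim: s => [|p s IH] /=.
  by split=> //; apply/setP=> q; rewrite inE.
case/andP=> ps us /andP[/eqP pi si]; have [aB eB] := IH us si.
split; first exact: toggle_antichain.
set B := foldr _ _ _ in aB eB *.
have pB : (p \in B) = (p \in X) by rewrite eB inE (negPf ps).
have sX x : x \in s -> (x == p) || ~~ ((x <= p)%O || (p <= x)%O).
  move=> xs; have /eqP xi := allP si x xs.
  case: eqP => //= xp; apply/norP; split; apply/negP; rewrite le_eqVlt;
    by case/orP=> [/eqP ?|/rk_lt]; [exact: xp | rewrite xi pi ltnn].
have compE : comparable_in B p = comparable_in X p.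
  apply/comparable_inP/comparable_inP=> -[x xX xp]; exists x => //.
    move: xX; rewrite eB inE; case: ifP => // xs _.
    have /orP[/eqP xE|] := sX x xs; last by rewrite xp.
    by rewrite -xE xs in ps.
  rewrite eB inE; case: ifP => // xs.
  have /orP[/eqP xE|] := sX x xs; last by rewrite xp.
  by rewrite -xE xs in ps.
have newE : toggle p B = if comparable_in X p then B :\ p else p |: B.
  rewrite /toggle pB; case: ifP => pX.
    suff -> : comparable_in X p by [].
    by apply/comparable_inP; exists p => //; rewrite lexx.
  have pB' : p \notin B by rewrite pB pX.
  have -> : B :\ p = B.
    by apply/setP=> x; rewrite !inE; case: eqP => //= ->; rewrite (negPf pB').
  rewrite -compE; case: ifP => [/antichainP aP|/negP aP].
    case: ifP => // /comparable_inP[x xB xp].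
    have [] : p <> x by move=> pE; rewrite pE xB in pB'.
    by case/orP: xp => xp; [apply/esym|]; apply: aP xp; rewrite !inE ?eqxx ?xB ?orbT.
  case: ifP => // /negbT nc; case: aP; apply/antichainP=> x y.
  rewrite !inE => /orP[/eqP->|xB] /orP[/eqP->|yB] xy //; last exact: (antichainP _ aB).
    by case/negP: nc; apply/comparable_inP; exists y; rewrite ?xy ?orbT.
  by case/negP: nc; apply/comparable_inP; exists x; rewrite ?xy ?orbT.
rewrite newE; apply/setP=> q; rewrite inE in_cons.
have [->|qp] := eqVneq q p; first by case: ifP; rewrite !inE ?eqxx // pB.
by case: ifP; rewrite !inE (negPf qp) /= eB inE.
Qed.

Lemma rank_toggleE (i : nat) X : antichain X ->
  antichain (rank_toggle rk i X) /\
  rank_toggle rk i X =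
    [set q | if rk q == i then ~~ comparable_in X q else q \in X].
Proof.
move=> aX; have [||aY eY] := @foldr_toggle i X (enum [pred p | rk p == i]) aX.
- exact: enum_uniq.
- by apply/allP=> p; rewrite mem_enum.
by split=> //; rewrite /rank_toggle eY; apply/setP=> q; rewrite !inE mem_enum.
Qed.

Lemma rk_max q : rk q <= max_rank rk.
Proof. exact: (leq_bigmax (F := rk)). Qed.

(** Ranks are settled one at a time: after ranks [r] to [r + k - 1] the antichain is final there and
    still [X] elsewhere. At the next rank, having no element of [X] at or above [q] puts [q] outside
    the ideal, and having no element of the current antichain below [q] puts everything below [q]
    inside it. *)
Lemma rank_toggles_fromE r X : antichain X ->
  rank_toggles_from rk r X = min_compl (block_ideal r X).
Proof.
move=> aX; set Y := min_compl _.
suff H k : let S := foldl (fun B j => rank_toggle rk j B) X (iota r k) in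
    antichain S /\
    S = [set q | if r <= rk q < r + k then q \in Y else q \in X].
  rewrite /rank_toggles_from; have [_ ->] := H ((max_rank rk).+1 - r).
  apply/setP=> q; rewrite inE; case: ifP => // qr.
  by rewrite min_compl_block_low //; have := rk_max q; lia.
elim: k => [|k IH].
  by split=> //; apply/setP=> q; rewrite inE addn0; case: ifP => //; lia.
rewrite -addn1 iotaD foldl_cat /=.
set S := foldl _ _ _ in IH *; case: IH => aS eS.
have [aS' ->] := rank_toggleE (r + k) aS; split.
  by have [? <-] := rank_toggleE (r + k) aS.
apply/setP=> q; rewrite [LHS]inE [RHS]inE; case: (eqVneq (rk q) (r + k)) => qk; last first.
  by rewrite eS inE; congr (if _ then _ else _); lia.
have -> : (r <= rk q < r + (k + 1)) by lia.
have SX x : rk q <= rk x -> (x \in S) = (x \in X).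
  by move=> qx; rewrite eS inE; case: ifP => //; lia.
rewrite /comparable_in; apply/idP/min_complP.
  move/exists_inPn=> nc; split.
    rewrite inE; case: ltnP => [|_]; first lia.
    apply/negP=> /exists_inP[x xX qx].
    by have := nc x; rewrite SX ?rk_le // xX qx orbT => /(_ isT).
  move=> p pq; apply/negPn/negP=> pz.
  have [y yM yp] := min_compl_ex pz.
  have yq : (y < q)%O by apply: le_lt_trans yp pq.
  suff yS : y \in S by have := nc y yS; rewrite (ltW yq).
  rewrite eS inE; have := rk_lt yq; case: ifP => // yr yq'.
  by rewrite -(@min_compl_block_low r) //; lia.
case; rewrite inE; case: ltnP => [|_ /exists_inPn nX Hp]; first lia.
apply/exists_inPn=> x xS; apply/norP; split; last first.
  apply/negP=> qx; have := nX x; rewrite -SX ?rk_le // xS qx.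
  by move/(_ isT).
have [xE|xq'] := eqVneq x q.
  by have := nX q; rewrite -SX // -xE xS lexx => /(_ isT).
apply/negP=> xq; have {xq xq'}xq : (x < q)%O by rewrite lt_neqAle xq'.
have xz := Hp x xq; move: xS; rewrite eS inE; have := rk_lt xq.
case: ifP => [_ _ /min_complP[]|xr rxq xX]; first by rewrite xz.
have xr' : rk x < r by lia.
move: xz; rewrite inE xr' => /exists_inPn/(_ x xX).
by rewrite lexx.
Qed.

(** [P r] speaks of the antichain on which block [r] is about to act. *)
Lemma Rvac_ind (P : nat -> {set T} -> Prop) X :
  antichain X -> P 0 X ->
  (forall r Y, antichain Y -> P r Y -> P r.+1 (min_compl (block_ideal r Y))) ->
  P (max_rank rk).+1 (Rvac rk X).
Proof.
move=> aX P0 PS; rewrite /Rvac.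
suff H k : let S := foldl (fun B i => rank_toggles_from rk i B) X (iota 0 k) in
  antichain S /\ P k S by case: (H (max_rank rk).+1).
elim: k => [|k IH] //; rewrite -addn1 iotaD foldl_cat /= add0n addn1.
set S := foldl _ _ _ in IH *; case: IH => aS PS'.
by rewrite rank_toggles_fromE //; split; [exact: min_compl_antichain | exact: PS].
Qed.

End RowvacuationBlocks.

(** * Coordinates on the root poset of type D *)

Section Coordinates.
Import GRing.Theory Num.Theory.
Local Open Scope ring_scope.
Variable n : nat.
Hypothesis n1 : (1 < n)%N.
Implicit Types (i c : nat) (s : bool) (u : nat -> int) (v : 'rV[int]_n).

(* Coordinates [(i, c, s)], with indices starting at 1: [e_i - e_j] is
   [(i, j, false)] and [e_i + e_j] is [(i, 2n - j, j == n)], so that the sign [s]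
   only matters in column [n]. The rank is then [c - i - 1]. *)
Definition minus_type c s : bool := ((c < n) || ((c == n) && ~~ s))%N.

Definition root_at i c s : 'rV[int]_n :=
  if minus_type c s then evec n i.-1 - evec n c.-1
  else evec n i.-1 + evec n (2 * n - c).-1.

Definition valid_coord i c s : bool :=
  [&& 0 < i, i < c, i + c < 2 * n & s ==> (c == n)]%N.

Definition pairing u v : int := \sum_(j < n) v ord0 j * u j.

Lemma pairingD u v w : pairing u (v + w) = pairing u v + pairing u w.
Proof. by rewrite -big_split; apply: eq_bigr => j _; rewrite mxE mulrDl. Qed.

Lemma pairing0 u : pairing u 0 = 0.
Proof. by rewrite /pairing big1 // => j _; rewrite mxE mul0r. Qed.

Lemma pairingN u v : pairing u (- v) = - pairing u v.
Proof. by rewrite -sumrN; apply: eq_bigr => j _; rewrite mxE mulNr. Qed.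

Lemma pairingMn u v m : pairing u (v *+ m) = pairing u v *+ m.
Proof.
by elim: m => [|m IH]; rewrite ?mulr0n ?pairing0 // !mulrS pairingD IH.
Qed.

Lemma pairing_evec u k : (k < n)%N -> pairing u (evec n k) = u k.
Proof.
move=> kn; rewrite /pairing (bigD1 (Ordinal kn)) //= mxE eqxx mul1r big1.
  by rewrite addr0.
by move=> j; rewrite -val_eqE /= mxE => /negbTE ->; rewrite mul0r.
Qed.

(** Nonnegativity on the simple roots: such functionals are monotone for the root order and serve as
    tests against comparability. *)
Definition dominant u : Prop :=
  (forall k, (k.+1 < n)%N -> u k.+1 <= u k) /\ 0 <= u n.-2 + u n.-1.

Lemma pairing_comb_ge0 u (c : 'I_n -> nat) :
  dominant u -> 0 <= pairing u (simple_comb c).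
Proof.
move=> [u1 u2]; rewrite /simple_comb.
rewrite (big_morph _ (@pairingD u) (@pairing0 u)) sumr_ge0 // => k _.
rewrite pairingMn mulrn_wge0 // /simpleD; case: ifP => kn.
  by rewrite pairingD pairingN !pairing_evec ?ltn_ord // subr_ge0 u1.
by rewrite pairingD !pairing_evec //; lia.
Qed.

Lemma pairing_root u i c s : valid_coord i c s ->
  pairing u (root_at i c s) =
    if minus_type c s then u i.-1 - u c.-1 else u i.-1 + u (2 * n - c).-1.
Proof.
rewrite /valid_coord /root_at /minus_type => /and4P[i0 ic icn sn].
by case: ifP => mt; rewrite pairingD ?pairingN !pairing_evec //; lia.
Qed.

Lemma root_le_pairing u i c s i' c' s' :
  valid_coord i c s -> valid_coord i' c' s' ->
  (exists f : 'I_n -> nat, root_at i' c' s' - root_at i c s = simple_comb f) ->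
  dominant u ->
  (if minus_type c s then u i.-1 - u c.-1 else u i.-1 + u (2 * n - c).-1) <=
  (if minus_type c' s' then u i'.-1 - u c'.-1 else u i'.-1 + u (2 * n - c').-1).
Proof.
move=> vt vt' [f Hf] du; rewrite -!pairing_root // -subr_ge0.
by rewrite -pairingN -pairingD Hf pairing_comb_ge0.
Qed.

Definition coord_le i c s i' c' s' : bool :=
  [&& i' <= i, c <= c' & (c == n) && (c' == n) ==> (s == s')]%N.

Lemma root_le_coord i c s i' c' s' :
  valid_coord i c s -> valid_coord i' c' s' ->
  (exists f : 'I_n -> nat, root_at i' c' s' - root_at i c s = simple_comb f) ->
  coord_le i c s i' c' s'.
Proof.
move=> vt vt' Hf.
(* [step i] compares rows; [step n] is 0 on differences e_a - e_b and 2 on sums e_a + e_b; [step c']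
   compares the columns of two differences, [step (2 * n - c)] those of two sums. *)
pose step k : nat -> int := fun j => ((j < k)%N : nat)%:Z.
have dstep k : dominant (step k) by rewrite /dominant /step; split=> [j|]; lia.
(* The vector (1, ..., 1, -1) takes the value 2 on e_i - e_n and 0 on e_i + e_n, which excludes the
   remaining comparison inside column [n]. *)
have dlast : dominant (fun j => 1 - 2 * ((n.-1 <= j)%N : nat)%:Z).
  by rewrite /dominant; split=> [j|]; lia.
have Hi := root_le_pairing vt vt' Hf (dstep i).
have H1 := root_le_pairing vt vt' Hf (dstep n).
have Hj := root_le_pairing vt vt' Hf (dstep (2 * n - c)%N).
have Hc := root_le_pairing vt vt' Hf (dstep c').
have Hl := root_le_pairing vt vt' Hf dlast.
move: vt vt' Hi H1 Hj Hc Hl; rewrite /valid_coord /coord_le /step.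
move=> /and4P[i0 ic icn sn] /and4P[i0' ic' icn' sn'] Hi H1 Hj Hc Hl; clear Hf dstep dlast step.
have le_row : (i' <= i)%N.
  clear H1 Hj Hl Hc sn sn'; rewrite leqNgt; apply/negP=> ii'; move: Hi.
  have -> : (i.-1 < i)%N by lia.
  have -> : (i'.-1 < i)%N = false by lia.
  by do 2![case: ifP => _]; lia.
have not_pm : minus_type c' s' -> minus_type c s.
  move=> m2; apply/negPn/negP=> m1; move: H1; rewrite m2 (negPf m1).
  have -> : (i.-1 < n)%N by lia.
  have -> : (i'.-1 < n)%N by lia.
  have -> : (c'.-1 < n)%N by move: m2; rewrite /minus_type; lia.
  have -> : ((2 * n - c).-1 < n)%N by move: m1; rewrite /minus_type; lia.
  by [].
have le_col : (c <= c')%N.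
  clear Hl H1; rewrite leqNgt; apply/negP=> cc'.
  have [m2|m2] := boolP (minus_type c' s').
    move: Hc Hi; rewrite m2 not_pm //.
    have -> : (i.-1 < i)%N by lia.
    have -> : (c.-1 < i)%N = false by lia.
    have -> : (i'.-1 < i)%N by lia.
    case: (ltnP c'.-1 i) => // ic'' + _.
    have -> : (i.-1 < c')%N by lia.
    have -> : (c.-1 < c')%N = false by lia.
    have -> : (i'.-1 < c')%N by lia.
    by have -> : (c'.-1 < c')%N by lia.
  have m1 : minus_type c s = false by move: m2; rewrite /minus_type; lia.
  move: Hj; rewrite (negPf m2) m1.
  have -> : (i.-1 < 2 * n - c)%N by lia.
  have -> : ((2 * n - c).-1 < 2 * n - c)%N by lia.
  have -> : ((2 * n - c').-1 < 2 * n - c)%N = false by lia.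
  by case: (_ < _)%N.
rewrite le_row le_col /=; apply/implyP=> /andP[/eqP cn /eqP cn'].
move: Hl not_pm; rewrite /minus_type cn cn' ltnn eqxx /=.
case: (s) (s') => [] [] //= Hl npm; first by have := npm isT.
move: Hl; have -> : (n.-1 <= i.-1)%N = false by lia.
have -> : (n.-1 <= i'.-1)%N = false by lia.
have -> : ((2 * n - n).-1 = n.-1)%N by lia.
by rewrite leqnn.
Qed.

Definition is_comb v : Prop := exists f : 'I_n -> nat, v = simple_comb f.

Lemma is_combD v w : is_comb v -> is_comb w -> is_comb (v + w).
Proof. by move=> [f ->] [g ->]; eexists; apply: simple_combD. Qed.

Lemma is_comb_evecB k l : (k <= l < n)%N -> is_comb (evec n k - evec n l).
Proof.
by case/andP=> kl ln; rewrite -(subnKC kl); apply: evecB_comb; rewrite subnKC.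
Qed.

Lemma is_comb_evecD_lt k l : (k < l < n)%N -> is_comb (evec n k + evec n l).
Proof.
case/andP=> kl ln.
have kn : (k < n)%N := ltn_trans kl ln.
have vP : evec n k + evec n l \in posrootsD n.
  by apply/posrootsDP; exists (Ordinal kn), (Ordinal ln); split; [|right].
by have [f fE] := PhiD_comb (SeqSub vP); exists f.
Qed.

Lemma is_comb_evecD k l : (k < n)%N -> (l < n)%N -> (k < n.-1)%N || (l < n.-1)%N ->
  is_comb (evec n k + evec n l).
Proof.
move=> kn ln kl; case: (ltngtP k l) => [kl'|kl'|kl'].
- by apply: is_comb_evecD_lt; rewrite kl'.
- by rewrite addrC; apply: is_comb_evecD_lt; rewrite kl'.
(* Here [k = l] and the sum is not a root; it is split through the last coordinate. *)
rewrite -kl' -[evec n k as X in X + _](subrK (evec n n.-1)) -addrA.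
apply: is_combD; first by apply: is_comb_evecB; lia.
by rewrite addrC; apply: is_comb_evecD_lt; lia.
Qed.

(** The difference splits into a row part and a column part, each a nonnegative combination of
    simple roots. *)
Lemma coord_le_root i c s i' c' s' :
  valid_coord i c s -> valid_coord i' c' s' -> coord_le i c s i' c' s' ->
  is_comb (root_at i' c' s' - root_at i c s).
Proof.
rewrite /valid_coord /coord_le /root_at /minus_type.
move=> /and4P[i0 ic icn sn] /and4P[i0' ic' icn' sn'] /and3P[ii' cc' ss'].
have rowc : is_comb (evec n i'.-1 - evec n i.-1).
  by apply: is_comb_evecB; lia.
case: ifP => m2; case: ifP => m1.
- have -> : evec n i'.-1 - evec n c'.-1 - (evec n i.-1 - evec n c.-1) =
    (evec n i'.-1 - evec n i.-1) + (evec n c.-1 - evec n c'.-1) by apply/rowP=> j; rewrite !mxE; ring.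
  by apply: is_combD => //; apply: is_comb_evecB; lia.
- by exfalso; case: s s' ss' sn sn' m1 m2 => [] []; lia.
- have -> : evec n i'.-1 + evec n (2 * n - c').-1 - (evec n i.-1 - evec n c.-1) =
    (evec n i'.-1 - evec n i.-1) + (evec n c.-1 + evec n (2 * n - c').-1) by apply/rowP=> j; rewrite !mxE; ring.
  apply: is_combD => //; apply: is_comb_evecD; last first.
  + by case: s s' ss' sn sn' m1 m2 => [] []; lia.
  + by lia.
  + by lia.
- have -> : evec n i'.-1 + evec n (2 * n - c').-1 -
      (evec n i.-1 + evec n (2 * n - c).-1) =
    (evec n i'.-1 - evec n i.-1) +
    (evec n (2 * n - c').-1 - evec n (2 * n - c).-1) by apply/rowP=> j; rewrite !mxE; ring.
  by apply: is_combD => //; apply: is_comb_evecB; lia.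
Qed.

Lemma root_at_pos i c s : valid_coord i c s -> root_at i c s \in posrootsD n.
Proof.
rewrite /valid_coord /root_at /minus_type => /and4P[i0 ic icn sn].
have in' : (i.-1 < n)%N by lia.
apply/posrootsDP; case: ifP => m.
  have cn : (c.-1 < n)%N by lia.
  by exists (Ordinal in'), (Ordinal cn); split; [rewrite /=; lia | left].
have cn : ((2 * n - c).-1 < n)%N by lia.
by exists (Ordinal in'), (Ordinal cn); split; [rewrite /=; lia | right].
Qed.

End Coordinates.

(** * Order and rank of positive roots in coordinates *)

Section RootCoordinates.
Import GRing.Theory Num.Theory.
Variable n : nat.
Implicit Types (a b : PhiD n) (i c : nat) (s : bool).

Lemma coord_ex a : exists t : nat * nat * bool,
  valid_coord n t.1.1 t.1.2 t.2 && (ssval a == root_at n t.1.1 t.1.2 t.2).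
Proof.
have n1 := PhiD_gt1 a; have /posrootsDP[i [j [ij Hv]]] := ssvalP a.
have jn := ltn_ord j; case: Hv => ->.
  exists (i.+1, j.+1, false); rewrite /valid_coord /root_at /minus_type /= andbT.
  apply/andP; split; first lia.
  by case: ifP => // /negP[]; lia.
exists (i.+1, 2 * n - j.+1, j.+1 == n); rewrite /valid_coord /root_at /minus_type /=.
apply/andP; split; first lia.
case: ifP => [|_]; first lia.
by rewrite subKn //; lia.
Qed.

Definition coord a : nat * nat * bool := xchoose (coord_ex a).
Definition rowD a : nat := (coord a).1.1.
Definition colD a : nat := (coord a).1.2.
Definition sgnD a : bool := (coord a).2.

Lemma coord_valid a : valid_coord n (rowD a) (colD a) (sgnD a).
Proof. by have /andP[] := xchooseP (coord_ex a). Qed.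

Lemma coordE a : ssval a = root_at n (rowD a) (colD a) (sgnD a).
Proof. by have /andP[_ /eqP] := xchooseP (coord_ex a). Qed.

Lemma le_coordE a b :
  (a <= b)%O = coord_le n (rowD a) (colD a) (sgnD a) (rowD b) (colD b) (sgnD b).
Proof.
have n1 := PhiD_gt1 a.
have va := coord_valid a; have vb := coord_valid b.
apply/asboolP/idP; rewrite (coordE a) (coordE b).
  exact: root_le_coord.
exact: coord_le_root.
Qed.

Lemma coord_inj a b :
  rowD a = rowD b -> colD a = colD b -> sgnD a = sgnD b -> a = b.
Proof. by move=> e1 e2 e3; apply/val_inj; rewrite /= !coordE e1 e2 e3. Qed.

Lemma coord_surj i c s : 1 < n -> valid_coord n i c s ->
  exists a, [/\ rowD a = i, colD a = c & sgnD a = s].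
Proof.
move=> n1 v; pose a : PhiD n := SeqSub (root_at_pos n1 v); exists a.
have va := coord_valid a.
have E : root_at n (rowD a) (colD a) (sgnD a) = root_at n i c s.
  by rewrite -coordE.
(* Uniqueness of coordinates comes from the order: a zero difference makes two triples [coord_le]
   each other. *)
have comb0 : exists f : 'I_n -> nat, (0 = simple_comb f)%R.
  by exists (fun=> 0); rewrite /simple_comb big1 // => k _; rewrite mulr0n.
have /and3P[r1 c1 s1] : coord_le n (rowD a) (colD a) (sgnD a) i c s.
  by apply: root_le_coord => //; rewrite E subrr.
have /and3P[r2 c2 s2] : coord_le n i c s (rowD a) (colD a) (sgnD a).
  by apply: root_le_coord => //; rewrite E subrr.
have cE : colD a = c by apply/anti_leq/andP.
split=> //; first by apply/anti_leq/andP.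
have /and4P[_ _ _ sc] := v; have /and4P[_ _ _ sa] := va; rewrite cE in s1 sa.
by move: s1 sa sc; case: eqP => //= _; case: (sgnD a) (s) => [] [].
Qed.

Lemma rkE a : rkD a = colD a - rowD a - 1.
Proof.
have n1 := PhiD_gt1 a; rewrite /rkD.
have [f Hf] := PhiD_comb a; rewrite (heightDE Hf).
have := rho_pair_comb f n1; rewrite -Hf coordE /root_at.
move: (\sum_(k < n) f k) => S.
have /and4P[r0 rc rcn _] := coord_valid a.
case: ifP => m; rewrite rho_pairD ?rho_pairN !rho_pair_evec ?natz;
  by move: m; rewrite /minus_type; lia.
Qed.

Lemma rk_lt a b : (a < b)%O -> rkD a < rkD b.
Proof.
rewrite lt_neqAle le_coordE !rkE => /andP[/eqP ab /and3P[r c s]].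
have /and4P[a0 a1 a2 a3] := coord_valid a; have /and4P[b0 b1 b2 b3] := coord_valid b.
suff : rowD a <> rowD b \/ colD a <> colD b by lia.
have [rE|] := eqVneq (rowD a) (rowD b); last by move/eqP; left.
have [cE|] := eqVneq (colD a) (colD b); last by move/eqP; right.
case: ab; apply: coord_inj => //; move: s a3 b3; rewrite cE.
by case: eqP => //=; case: (sgnD a) (sgnD b) => [] [].
Qed.

End RootCoordinates.

(** * Telescoping sums of column heights *)

Ltac split_cmp :=
  repeat (match goal with
  | |- context [leq ?a ?b] => case: (leqP a b) => ?
  | |- context [@eq_op _ ?a ?b] => case: (@eqP _ a b) => ?
  end; rewrite /= ?andbF ?orbF ?orbT; try (exfalso; lia)); try lia.

Section HeightSums.
Variable n : nat.
Hypothesis n1 : 1 < n.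

(** Reattaches the terms of column [c + 1] to column [c], so that sums can be compared column by
    column. *)
Lemma sum_shift (F : nat -> nat) m : 0 < m -> F 1 = 0 -> F m = 0 ->
  \sum_(1 <= c < m) F c.+1 = \sum_(1 <= c < m) F c.
Proof.
case: m => // m _ F1 Fm; rewrite -(big_add1 _ _ 1 m.+2 xpredT) /=.
case: m Fm => [|m] Fm; first by rewrite !big_geq.
by rewrite big_nat_recr //= Fm addn0 [in RHS]big_ltn // F1.
Qed.

Lemma sum_delta (F : nat -> nat) k m : 0 < k < m ->
  \sum_(1 <= c < m) (c == k) * F c = F k.
Proof.
case/andP=> k0 km; rewrite (big_cat_nat (n := k)) ?(ltnW km) //=.
rewrite [X in _ + X]big_ltn // eqxx mul1n !big1_seq ?addn0 //.
  by move=> c /andP[_]; rewrite mem_index_iota => /andP[kc _]; rewrite gtn_eqF.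
by move=> c /andP[_]; rewrite mem_index_iota => /andP[_ kc]; rewrite ltn_eqF.
Qed.

(* [t c] is the top row occupied by a down-set in column [c]; the rows of that
   column are [1, ..., minn c (2n - c) - 1], and an empty column has
   [t c = minn c (2n - c)]. *)
Definition height_fun (t : nat -> nat) : Prop :=
  (forall c, 0 < c < 2 * n -> 0 < t c <= minn c (2 * n - c)) /\
  (forall c, 0 < c -> c.+1 < 2 * n ->
     (c < n) || (t c.+1 < 2 * n - c.+1) -> t c <= t c.+1).

(** The cell in row [t c] has rank [c - t c - 1], here at least [r]. For an empty column beyond [n]
    this cell is virtual, just past the diagonal, and the test can still hold. *)
Definition deep (r : nat) (t : nat -> nat) c : bool := t c + r < c.

(** The only element of the column is its diagonal cell, in row [2n - c - 1]; for [c > n] this is a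
    root e_i + e_{i+1}. *)
Definition on_diag (t : nat -> nat) c : bool := (n <= c) && ((t c + c).+1 == 2 * n).

(** The column is empty, so its lowest missing cell is the diagonal one. *)
Definition over_diag (t : nat -> nat) c : bool := (n <= c) && (t c + c == 2 * n).

(** The diagonal reaches rank [r] in column [n + r/2]. The nonempty columns from there on, marked by
    [D], form a run; if there is one, its end is counted once, by the first sum if its last column
    holds only a diagonal cell, otherwise by the second sum one column later. *)
Lemma sum_diag r t : height_fun t -> ~~ odd r ->
  \sum_(1 <= c < (2 * n).-1) (deep r t c && on_diag t c : nat) +
  \sum_(1 <= c < (2 * n).-1) ([&& deep r t c, t c.-1 < t c & over_diag t c] : nat) =
  \sum_(1 <= c < (2 * n).-1) ((2 * c == 2 * n + r) && deep r t c : nat).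
Proof.
move=> [t_rng t_mono] odd_r.
pose D c : nat := [&& n <= c, 2 * n + r <= 2 * c & t c + c < 2 * n].
have tl := t_rng (2 * n).-1; have t1 := t_rng 1.
rewrite -[X in _ + X = _]sum_shift; first last.
- rewrite /over_diag /deep; have := t_rng (2 * n).-2; lia.
- by rewrite /over_diag /deep; lia.
- by lia.
rewrite -[RHS]sum_shift; first last.
- by rewrite /deep; lia.
- by rewrite /deep; lia.
- by lia.
have DE : \sum_(1 <= c < (2 * n).-1) D c.+1 = \sum_(1 <= c < (2 * n).-1) D c.
  by apply: sum_shift; rewrite /D; lia.
apply/(@addIn (\sum_(1 <= c < (2 * n).-1) D c)); rewrite -[in LHS]DE -!big_split /=.
rewrite big_nat_cond [RHS]big_nat_cond; apply: eq_bigr => c; rewrite andbT => /andP[c0 cn].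
have : 0 < t c <= minn c (2 * n - c) by apply: t_rng; lia.
have : 0 < t c.+1 <= minn c.+1 (2 * n - c.+1) by apply: t_rng; lia.
have := t_mono c c0; rewrite /D /deep /on_diag /over_diag /=.
have -> : c.+1 < 2 * n by lia.
move=> /(_ isT); clear t_mono t_rng t1 tl DE D.
move: (t c) (t c.+1) => x y xy; rewrite !leq_min => /and3P[y0 y1 y2] /and3P[x0 x1 x2].
have {xy}xy : c < n \/ y < 2 * n - c.+1 -> x <= y by move=> H; apply: xy; lia.
split_cmp.
Qed.

(** A jump [x < y] gives a maximal element in column [c] and a minimal non-element in column
    [c + 1], unless it crosses the line of rank [r]; then a cell of rank [r] in column [c] has no
    counterpart of rank [r + 1] in column [c + 1]. The remaining terms are the boundary on the
    diagonal. *)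
Lemma column_step r c x y : 0 < c -> c.+1 < 2 * n ->
  0 < x <= minn c (2 * n - c) -> 0 < y <= minn c.+1 (2 * n - c.+1) ->
  ((c < n) || (y < 2 * n - c.+1) -> x <= y) ->
  ((x + r < c) && (2 * c <= 2 * n + r) : nat) + ((y + r < c.+1) && (x < y)) +
  [&& x + r < c, n <= c & (x + c).+1 == 2 * n] =
  [&& y + r < c.+1, x + r < c & 2 * c.+1 <= (2 * n + r).+1] +
  ((x + r < c) && ((x < y) || (n <= c) && ((x + c).+1 == 2 * n))) +
  ((2 * c == 2 * n + r) && (x + r < c)).
Proof.
move=> c0 cn; rewrite !leq_min => /and3P[x0 x1 x2] /and3P[y0 y1 y2] xy.
have {xy}xy : c < n \/ y < 2 * n - c.+1 -> x <= y by move=> H; apply: xy; lia.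
split_cmp.
Qed.

(* Column [n + r], bent along row [n - r - 1] below the diagonal. *)
Definition hook r i c : bool :=
  (c == n + r) && (i + r < n) || (i + r.+1 == n) && (n <= c < n + r).

(** * Balance with column [n] doubled *)

Section TwoSheets.
Variable t : bool -> nat -> nat.
Hypothesis t_fun : forall s, height_fun (t s).
Hypothesis t_eq : forall s (c : nat), c != n -> t s c = t false c.
Variable r : nat.

Definition sum_columns (F : bool -> nat -> bool) : nat :=
  \sum_(1 <= c < (2 * n).-1) F false c + F true n.

(* Whether column [c] of sheet [s] contains a maximal element of rank [>= r], a
   minimal non-element of rank [> r], an element of rank [r], and an element of
   rank [r.+1] with everything below it in the down-set. *)
Definition is_max s c : bool :=
  deep r (t s) c &&
  ((t s c < t false c.+1) && (t s c < t true c.+1) || on_diag (t s) c).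

Definition is_min s c : bool :=
  [&& deep r (t s) c, t false c.-1 < t s c & t true c.-1 < t s c].

Definition is_level s c : bool := deep r (t s) c && (2 * c <= 2 * n + r).

Definition is_next s c : bool :=
  [&& deep r (t s) c, deep r (t false) c.-1, deep r (t true) c.-1 &
      2 * c <= (2 * n + r).+1].

Definition diag_max s c : bool := is_max s c && on_diag (t s) c.
Definition diag_min s c : bool := is_min s c && over_diag (t s) c.

Definition hook_max s c : bool := [&& is_max s c, ~~ s & hook r (t s c) c].
Definition hook_min s c : bool := [&& is_min s c, ~~ s & hook r.+1 (t s c).-1 c].

Lemma t_rng s c : 0 < c < 2 * n -> 0 < t s c <= minn c (2 * n - c).
Proof. by case: (t_fun s) => H _; apply: H. Qed.

Lemma t_mono s s' c : 0 < c -> c.+1 < 2 * n ->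
  (c < n) || (t s c.+1 < 2 * n - c.+1) -> t s' c <= t s c.+1.
Proof.
move=> c0 cn tc; have [_ H] := t_fun s; have [cn'|cn'] := eqVneq c n.
  have [_ H'] := t_fun s'; rewrite (t_eq s) in tc *; last by lia.
  by rewrite -(t_eq s'); [apply: H' => //; rewrite (t_eq s')|]; lia.
by rewrite t_eq // -(t_eq s) //; apply: H.
Qed.

(** The telescoping runs along the sheet whose column [n] holds fewer elements, which need not be
    [false]. *)
Lemma sum_columnsE (F : bool -> nat -> bool) s :
  (forall s' (c : nat), c != n -> F s' c = F false c) ->
  sum_columns F = \sum_(1 <= c < (2 * n).-1) F s c + F (~~ s) n.
Proof.
move=> HF; rewrite /sum_columns; case: s => //=.
have nn : 0 < n < (2 * n).-1 by lia.
rewrite -(sum_delta (fun c => F true c) nn) -(sum_delta (fun c => F false c) nn).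
rewrite -!big_split /=; apply: eq_bigr => c _.
by case: eqVneq => [->|cn]; rewrite ?mul1n ?mul0n ?addn0; [lia | rewrite HF].
Qed.

Lemma sheet_eq s (c : nat) : c != n ->
  [/\ is_max s c = is_max false c, is_min s c = is_min false c,
      is_level s c = is_level false c & is_next s c = is_next false c].
Proof.
by move=> cn; rewrite /is_max /is_min /is_level /is_next /deep /on_diag (t_eq s).
Qed.

Lemma diag_eq s (c : nat) : c != n ->
  diag_max s c = diag_max false c /\ diag_min s c = diag_min false c.
Proof.
move=> cn; rewrite /diag_max /diag_min /on_diag /over_diag (t_eq s cn).
by have [-> -> _ _] := sheet_eq s cn.
Qed.

(** Parity decides which correction survives: for [r] odd no column has [2c = 2n + r], for [r] even
    [sum_diag] applies. As [t s n] is the larger height, it alone decides the two conditions of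
    [is_min] in column [n + 1]. *)
Lemma sum_diag_columns s : t (~~ s) n <= t s n ->
  \sum_(1 <= c < (2 * n).-1) ((2 * c == 2 * n + r) && deep r (t s) c : nat) +
    odd r * sum_columns diag_max =
  \sum_(1 <= c < (2 * n).-1) (deep r (t s) c && on_diag (t s) c : nat) +
    ~~ odd r * sum_columns diag_min.
Proof.
move=> ts; rewrite (@sum_columnsE diag_max s); last by move=> s' c /(diag_eq s')[].
rewrite (@sum_columnsE diag_min s); last by move=> s' c /(diag_eq s')[].
have maxE : \sum_(1 <= c < (2 * n).-1) diag_max s c =
    \sum_(1 <= c < (2 * n).-1) (deep r (t s) c && on_diag (t s) c : nat).
  apply: eq_bigr => c _; rewrite /diag_max /is_max.
  by case: (on_diag _ _); rewrite ?orbT ?andbT ?andbF.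
have minE : \sum_(1 <= c < (2 * n).-1) diag_min s c =
    \sum_(1 <= c < (2 * n).-1) ([&& deep r (t s) c, t s c.-1 < t s c & over_diag (t s) c] : nat).
  apply: eq_big_nat => c /andP[c0 cn]; congr (nat_of_bool _).
  rewrite /diag_min /is_min -!andbA; case: (deep _ _ _) => //=.
  case: (boolP (over_diag _ _)) => [/andP[nc /eqP tc]|]; rewrite ?andbF // !andbT.
  have [c1n|c1n] := eqVneq c.-1 n; last by rewrite (t_eq s c1n) (t_eq true c1n) andbb.
  by rewrite c1n; move: ts; case: (s) => /=; lia.
rewrite maxE minE.
have [odd_r|even_r] := boolP (odd r); last first.
  have -> : diag_min (~~ s) n = false.
    by rewrite /diag_min /is_min /over_diag /deep; apply/negP; lia.
  by rewrite mul0n !addn0 mul1n -(sum_diag (t_fun s) even_r).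
have -> : diag_max (~~ s) n = false.
  apply/negP; rewrite /diag_max /is_max /on_diag /deep => /andP[/andP[+ _]].
  by case: r odd_r => // r' _; lia.
rewrite /= mul1n mul0n !addn0 [X in X + _]big1_seq // => c _.
by case: eqP => // E; move/negP: odd_r; lia.
Qed.

(** Along sheet [s], whose column [n] holds fewer elements, [column_step] applies away from
    [c = n - 1]. The other copy of column [n] is entered as one extra term at [c = n - 1] and
    balances there. *)
Lemma column_balance_asym s : t (~~ s) n < t s n ->
  sum_columns is_level + sum_columns is_min + odd r * sum_columns diag_max =
  sum_columns is_next + sum_columns is_max + ~~ odd r * sum_columns diag_min.
Proof.
move=> ts; have tsW := ltnW ts; have E := sum_diag_columns tsW.
rewrite (@sum_columnsE is_level s); last by move=> s' c /(sheet_eq s')[].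
rewrite (@sum_columnsE is_min s); last by move=> s' c /(sheet_eq s')[].
rewrite (@sum_columnsE is_next s); last by move=> s' c /(sheet_eq s')[].
rewrite (@sum_columnsE is_max s); last by move=> s' c /(sheet_eq s')[].
have rng := t_rng; have mono := t_mono.
rewrite -[\sum_(_ <= _ < _) is_min s _]sum_shift; first last.
- by have := rng s (2 * n).-1; have := rng false (2 * n).-2; rewrite /is_min; lia.
- by have := rng s 1; rewrite /is_min /deep; lia.
- by lia.
rewrite -[\sum_(_ <= _ < _) is_next s _]sum_shift; first last.
- by have := rng s (2 * n).-1; have := rng false (2 * n).-2; rewrite /is_next /deep; lia.
- by have := rng s 1; rewrite /is_next /deep; lia.
- by lia.
suff step : \sum_(1 <= c < (2 * n).-1) is_level s c +
    \sum_(1 <= c < (2 * n).-1) is_min s c.+1 +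
    \sum_(1 <= c < (2 * n).-1) (deep r (t s) c && on_diag (t s) c : nat) +
    (is_level (~~ s) n + is_min (~~ s) n) =
    \sum_(1 <= c < (2 * n).-1) is_next s c.+1 +
    \sum_(1 <= c < (2 * n).-1) is_max s c +
    \sum_(1 <= c < (2 * n).-1) ((2 * c == 2 * n + r) && deep r (t s) c : nat) +
    (is_next (~~ s) n + is_max (~~ s) n) by lia.
have nn : 0 < n.-1 < (2 * n).-1 by lia.
rewrite -(sum_delta (fun=> is_level (~~ s) n + is_min (~~ s) n) nn).
rewrite -(sum_delta (fun=> is_next (~~ s) n + is_max (~~ s) n) nn).
rewrite -!big_split /=; apply: eq_big_nat => c /andP[c0 cn].
have c2n : c.+1 < 2 * n by lia.
have [cn1|cn1] := eqVneq c n.-1; last first.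
  rewrite !mul0n !addn0.
  have tS s' : t s' c.+1 = t s c.+1 by rewrite (t_eq s') ?(t_eq s) //; lia.
  have conj_lt y : (t false c < y) && (t true c < y) = (t s c < y).
    have [cE|cE] := eqVneq c n; first by rewrite cE; move: ts; case: (s) => /=; lia.
    by rewrite (t_eq s cE) (t_eq true cE) andbb.
  have conj_deep : deep r (t false) c && deep r (t true) c = deep r (t s) c.
    have [cE|cE] := eqVneq c n.
      by rewrite /deep cE; move: ts; case: (s) => /=; lia.
    by rewrite /deep (t_eq s cE) (t_eq true cE) andbb.
  have -> : is_min s c.+1 = (t s c.+1 + r < c.+1) && (t s c < t s c.+1).
    by rewrite /is_min /= conj_lt.
  have -> : is_next s c.+1 =
      [&& t s c.+1 + r < c.+1, t s c + r < c & 2 * c.+1 <= (2 * n + r).+1].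
    by rewrite /is_next /= [X in _ && X]andbA conj_deep.
  rewrite /is_level /is_max !tS andbb /on_diag /deep.
  apply: column_step => //; [|by apply: rng; lia|exact: mono].
  by apply: rng; lia.
have cn' : c != n by lia.
have cS : c.+1 = n by lia.
rewrite !mul1n /is_level /is_min /is_next /is_max /on_diag /deep /= -cn1 cS.
have /andP[z0 zb] : 0 < t s n.+1 <= minn n.+1 (2 * n - n.+1) by apply: rng; lia.
have zE s' : t s' n.+1 = t s n.+1 by rewrite (t_eq s') ?(t_eq s) //; lia.
have zmono := mono s s n; have ymono := mono (~~ s) s c.
have /andP[x0 xb] : 0 < t s c <= minn c (2 * n - c) by apply: rng; lia.
have /andP[y0 yb] : 0 < t (~~ s) n <= minn n (2 * n - n) by apply: rng; lia.
have /andP[y0' yb'] : 0 < t s n <= minn n (2 * n - n) by apply: rng; lia.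
have xE s' : t s' c = t s c by rewrite (t_eq s' cn') (t_eq s cn').
rewrite !zE (xE false) (xE true) !andbb.
have -> : (t s c < t false n) && (t s c < t true n) = (t s c < t (~~ s) n).
  by move: ts; case: (s) => /=; lia.
(* The top cell of the fuller copy is on the diagonal or has no right neighbour in the ideal, since
   the other copy already lacks that row. *)
have -> : (t (~~ s) n < t s n.+1) || (n <= n) && ((t (~~ s) n + n).+1 == 2 * n).
  by lia.
rewrite cS in ymono.
have {}ymono : t s c <= t (~~ s) n by apply: ymono; lia.
have {}xb : t s c <= c by lia.
have {}yb' : t s n <= n by lia.
move: (t s c) (t s n) (t (~~ s) n) xb x0 y0 y0' yb' ts ymono {rng mono E zmono yb tsW} => x y' y.
move=> xb x0 y0 y0' yb' ts ymono.
split_cmp.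
Qed.

Lemma sum_hook : t true n = t false n ->
  sum_columns hook_max + is_next true n = sum_columns hook_min + is_level true n.
Proof.
move=> tn; have t0 s c : t s c = t false c.
  by have [->|/t_eq->//] := eqVneq c n; case: s.
have rng := t_rng; have mono c := @t_mono false false c.
(* The quantity carried from column to column: column [c] contains row [n - r - 1], the arm of the
   hook for [r], while column [c - 1] lacks row [n - r - 2], the arm of the hook for [r + 1]. *)
pose pot c := [&& n <= c <= n + r, t false c + r < n & ~~ (t false c.-1 + r.+1 < n)].
(* [y] and [l] collect the minimal elements on the row and on the column of the hook for [r + 1]. *)
pose y c := [&& is_min false c, t false c + r.+1 == n & n <= c <= n + r].
pose l c := [&& is_min false c, c == (n + r).+1 & t false c + r < n].
have hook_minE : \sum_(1 <= c < (2 * n).-1) hook_min false c =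
    \sum_(1 <= c < (2 * n).-1) y c + \sum_(1 <= c < (2 * n).-1) l c.
  rewrite -big_split /=; apply: eq_big_nat => c /andP[c0 cn].
  have : 0 < t false c by have := rng false c; lia.
  rewrite /hook_min /y /l /hook; case: (is_min _ _) => //=; move: (t false c) => x x0.
  by split_cmp.
have -> : sum_columns hook_min = \sum_(1 <= c < (2 * n).-1) hook_min false c.
  by rewrite /sum_columns /hook_min andbF addn0.
have -> : sum_columns hook_max = \sum_(1 <= c < (2 * n).-1) hook_max false c.
  by rewrite /sum_columns /hook_max andbF addn0.
have potE : pot n + is_next true n = is_level true n.
  rewrite /pot /is_next /is_level /deep !(t0 true).
  move: (t false n) (t false n.-1) => a b; split_cmp.
rewrite hook_minE -potE.
suff : \sum_(1 <= c < (2 * n).-1) hook_max false c +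
    \sum_(1 <= c < (2 * n).-1) pot c.+1 =
    \sum_(1 <= c < (2 * n).-1) y c + \sum_(1 <= c < (2 * n).-1) l c.+1 +
    \sum_(1 <= c < (2 * n).-1) pot c +  pot n.
  rewrite (@sum_shift pot); first last.
  - by have := rng false (2 * n).-1; rewrite /pot; lia.
  - by rewrite /pot; lia.
  - by lia.
  rewrite (@sum_shift l); first last.
  - have := rng false (2 * n).-1; have := rng false (2 * n).-2.
    by rewrite /l /is_min /deep; clear; lia.
  - by have := rng false 1; rewrite /l /is_min /deep; lia.
  - by lia.
  by lia.
have nn : 0 < n.-1 < (2 * n).-1 by lia.
rewrite -(sum_delta (fun=> pot n : nat) nn) -!big_split /=.
apply: eq_big_nat => c /andP[c0 cn].
have cE : (c == n.-1) * pot n = (c == n.-1) && pot c.+1.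
  by case: eqP => [->|]; rewrite /= ?mul0n // mul1n prednK //; lia.
rewrite cE /hook_max /y /l /pot /is_max /is_min /hook /on_diag /deep /= !(t0 true) !andbb.
have := rng false c; have := rng false c.+1; have := rng false c.-1.
have := mono c c0; have := mono c.-1; rewrite prednK //.
move: (t false c.-1) (t false c) (t false c.+1) => a x z.
move=> ax xz ra rz rx; clear cE mono rng potE hook_minE t0 tn.
have {rx}[x0 x1 x2] : [/\ 0 < x, x <= c & x <= 2 * n - c] by split; lia.
have {rz}[z0 z1 z2] : [/\ 0 < z, z <= c.+1 & z <= 2 * n - c.+1] by split; lia.
have {xz}xz : c < n \/ z < 2 * n - c.+1 -> x <= z by move=> H; apply: xz; lia.
have {ax ra}ax : n <= c -> 0 < a /\ (x < 2 * n - c -> a <= x) by lia.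
case: (ltnP c n) => cn' /=; rewrite ?andbF /=.
  have {ax}xz' : x <= z by apply: xz; left.
  split_cmp.
have {ax}[a0 ax] := ax cn'.
case: (ltngtP c (n + r)) => cr /=; rewrite ?andbF /=.
- split_cmp.
- split_cmp.
- split_cmp.
Qed.

(** [column_step] balances a single sheet. Of the terms added by the second copy of column [n],
    [is_max] and [is_min] are cancelled by the explicit corrections, and [is_level] against
    [is_next] is absorbed by [sum_hook]. *)
Lemma column_balance_sym : t true n = t false n ->
  sum_columns is_level + sum_columns is_min + odd r * sum_columns diag_max +
    is_max true n + sum_columns hook_min =
  sum_columns is_next + sum_columns is_max + ~~ odd r * sum_columns diag_min +
    is_min true n + sum_columns hook_max.
Proof.
move=> tn; have t0 s c : t s c = t false c.
  by have [->|/t_eq->//] := eqVneq c n; case: s.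
have E := @sum_diag_columns false; have Eh := sum_hook tn.
rewrite tn leqnn in E; have {}E := E isT.
have rng := t_rng.
suff step : \sum_(1 <= c < (2 * n).-1) is_level false c +
    \sum_(1 <= c < (2 * n).-1) is_min false c +
    \sum_(1 <= c < (2 * n).-1) (deep r (t false) c && on_diag (t false) c : nat) =
    \sum_(1 <= c < (2 * n).-1) is_next false c +
    \sum_(1 <= c < (2 * n).-1) is_max false c +
    \sum_(1 <= c < (2 * n).-1) ((2 * c == 2 * n + r) && deep r (t false) c : nat).
  move: E Eh step; clear rng t0.
  rewrite [sum_columns is_level]/sum_columns [sum_columns is_min]/sum_columns.
  rewrite [sum_columns is_next]/sum_columns [sum_columns is_max]/sum_columns.
  move: (sum_columns _) (sum_columns _) (sum_columns _) (sum_columns _) => dM dm hM hm.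
  move: (is_level _ _) (is_next _ _) (is_min _ _) (is_max _ _) => b1 b2 b3 b4.
  (case: (odd r); rewrite /= ?mul1n ?mul0n; lia).
rewrite -[\sum_(_ <= _ < _) is_min _ _]sum_shift; first last.
- by have := rng false (2 * n).-1; have := rng false (2 * n).-2; rewrite /is_min; clear -n1; lia.
- by have := rng false 1; rewrite /is_min /deep; lia.
- by lia.
rewrite -[\sum_(_ <= _ < _) is_next _ _]sum_shift; first last.
- by have := rng false (2 * n).-1; have := rng false (2 * n).-2; rewrite /is_next /deep; clear -n1; lia.
- by have := rng false 1; rewrite /is_next /deep; lia.
- by lia.
rewrite -!big_split /=; apply: eq_big_nat => c /andP[c0 cn].
have -> : is_next false c.+1 = [&& deep r (t false) c.+1, deep r (t false) c &
    2 * c.+1 <= (2 * n + r).+1].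
  by rewrite /is_next /deep /= (t0 true) [X in _ && X]andbA andbb.
rewrite /is_level /is_min /is_max /= !(t0 true) !andbb /on_diag /deep.
apply: column_step => //.
- by lia.
- by apply: rng; lia.
- by apply: rng; lia.
- by apply: t_mono => //; lia.
Qed.

End TwoSheets.

End HeightSums.

(** * Column heights of a down-set *)

Section ColumnHeights.
Variable n : nat.
Hypothesis n1 : 1 < n.
Implicit Types (p q : PhiD n) (z : {set PhiD n}) (s : bool) (i c r : nat).

Lemma rk_row_col q : (rowD q + rkD q).+1 = colD q.
Proof. by have /and4P[] := coord_valid q; rewrite rkE; lia. Qed.

Lemma sgn_col q : sgnD q -> colD q = n.
Proof. by have /and4P[_ _ _] := coord_valid q; case: (sgnD q) => //= /eqP. Qed.

Lemma coord_bounds q : [/\ 0 < rowD q, rowD q < colD q & rowD q + colD q < 2 * n].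
Proof. by have /and4P[]:= coord_valid q. Qed.

Lemma same_sheet p q : (p <= q)%O -> colD p = colD q -> sgnD p = sgnD q.
Proof.
rewrite le_coordE => /and3P[_ _ ps] cE.
move: ps (@sgn_col p) (@sgn_col q); rewrite cE andbb.
by case: eqP => //= cn; case: (sgnD p) (sgnD q) => [] [] // _ H1 H2; case: cn; auto.
Qed.

Lemma lt_coordE p q : (p < q)%O = (p <= q)%O && ((rowD p != rowD q) || (colD p != colD q)).
Proof.
rewrite lt_neqAle andbC; case: (boolP (p <= q)%O) => //= pq.
have [rE|rE] := eqVneq (rowD p) (rowD q) => /=; last first.
  by apply/eqP=> pqE; rewrite pqE eqxx in rE.
have [cE|cE] := eqVneq (colD p) (colD q) => /=; last first.
  by apply/eqP=> pqE; rewrite pqE eqxx in cE.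
by apply/eqP; apply: coord_inj => //; apply: same_sheet.
Qed.

(** The sets to be counted meet each column of each sheet at most once; this turns their cardinals
    into the column sums above. *)
Lemma card_columns (S : {set PhiD n}) (rho : bool -> nat -> nat)
    (phi : bool -> nat -> bool) :
  (forall q, (q \in S) = (rowD q == rho (sgnD q) (colD q)) && phi (sgnD q) (colD q)) ->
  (forall s c, 0 < c < (2 * n).-1 -> s ==> (c == n) -> phi s c ->
     valid_coord n (rho s c) c s) ->
  #|S| = sum_columns n phi.
Proof.
move=> SE phi_valid; rewrite -sum1_card.
have nn : 0 < n < (2 * n).-1 by lia.
have -> : \sum_(q in S) 1 = \sum_(q in S) \sum_(1 <= c < (2 * n).-1) (c == colD q) * 1.
  by apply: eq_bigr => q _; rewrite sum_delta //; have [] := coord_bounds q; lia.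
rewrite exchange_big /sum_columns -(sum_delta (fun c => phi true c) nn) -big_split /=.
apply: eq_big_nat => c cn.
have cell s : \sum_(q in S | (colD q == c) && (sgnD q == s)) 1 =
    (s ==> (c == n)) && phi s c.
  have [/andP[sc ph]|nph] := boolP (_ && _).
    have [q [qr qc qs]] := coord_surj n1 (phi_valid s c cn sc ph).
    rewrite (big_pred1 q) // => p; rewrite SE /=.
    apply/idP/eqP => [/and3P[/andP[/eqP pr _] /eqP pc /eqP ps]|->].
      by apply: coord_inj; rewrite ?qr ?qc ?qs // pr pc ps.
    by rewrite qr qc qs !eqxx ph.
  rewrite /= (big_pred0 _ _ _ _) // => q; rewrite SE; apply: contraNF nph.
  move=> /and3P[/andP[_ ph] /eqP qc /eqP qs]; rewrite -qc -qs ph andbT.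
  by apply/implyP=> /sgn_col->.
transitivity (\sum_(q in S | (colD q == c) && (sgnD q == false)) 1 +
              \sum_(q in S | (colD q == c) && (sgnD q == true)) 1); last first.
  by rewrite !cell /=; case: (c == n); case: (phi true c); rewrite ?addn0.
rewrite [LHS](bigID (fun q => (colD q == c) && (sgnD q == false))) /=.
rewrite [X in _ + X = _](bigID (fun q => (colD q == c) && (sgnD q == true))) /=.
rewrite [X in _ + (_ + X)]big1 ?addn0 => [|q]; last first.
  rewrite -andbA => /and3P[_]; rewrite [c == _]eq_sym.
  by case: (colD q == c) => //=; case: (sgnD q).
congr (_ + _); first by apply: eq_bigr => q /andP[_ /andP[/eqP-> _]]; rewrite eqxx.
apply: eq_big => q; last by move=> /andP[_ /andP[/eqP-> _]]; rewrite eqxx.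
by case: (q \in S); case: (colD q == c); case: (sgnD q).
Qed.

Definition bottom_row c : nat := minn c (2 * n - c).

Definition in_cell z i c s : bool :=
  [exists q in z, [&& rowD q == i, colD q == c & sgnD q == s]].

(** The sign is dropped outside column [n], so both sheets agree there; [bottom_row] supplies the
    height of an empty column. *)
Lemma height_ex z s c : exists i,
  (0 < i) && ((bottom_row c <= i) || in_cell z i c (s && (c == n))).
Proof. by exists (maxn 1 (bottom_row c)); lia. Qed.

Definition height z s c : nat := ex_minn (height_ex z s c).

Variable z : {set PhiD n}.
Hypothesis z_down : downset z.

Lemma in_cellE q : in_cell z (rowD q) (colD q) (sgnD q) = (q \in z).
Proof.
apply/exists_inP/idP => [[p pz /and3P[/eqP pi /eqP pc /eqP ps]]|qz].
  by have <- : p = q by apply: coord_inj.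
by exists q; rewrite ?eqxx.
Qed.

Lemma height_rng s c : 0 < c < 2 * n -> 0 < height z s c <= bottom_row c.
Proof.
move=> cn; rewrite /height; case: ex_minnP => m /andP[m0 _] min_m.
by rewrite m0 min_m // leqnn /= /bottom_row; lia.
Qed.

Lemma mem_height q : (q \in z) = (height z (sgnD q) (colD q) <= rowD q).
Proof.
have [q0 q1 q2] := coord_bounds q.
have sE : sgnD q && (colD q == n) = sgnD q.
  by case: (boolP (sgnD q)) => //= /sgn_col->; rewrite eqxx.
rewrite /height; case: ex_minnP => m; rewrite sE => /andP[m0 Hm] min_m.
apply/idP/idP => [qz|mq].
  by apply: min_m; rewrite q0 in_cellE qz orbT.
have {}Hm : in_cell z m (colD q) (sgnD q) by move: Hm; rewrite /bottom_row; lia.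
have /exists_inP[p pz /and3P[/eqP pm /eqP pc /eqP ps]] := Hm.
apply: z_down pz; rewrite le_coordE /coord_le pm pc ps mq leqnn eqxx.
by rewrite implybT.
Qed.

Lemma height_eq s c : c != n -> height z s c = height z false c.
Proof.
move=> cn; rewrite /height; case: ex_minnP => m Hm m_min; case: ex_minnP => m' Hm' m_min'.
rewrite (negPf cn) andbF in Hm m_min; apply/eqP; rewrite eqn_leq m_min //.
by rewrite m_min'.
Qed.

Definition sheet s c : bool := s && (c == n).

Lemma height_sheet s c : height z (sheet s c) c = height z s c.
Proof. by rewrite /sheet; case: eqVneq => [|/(height_eq s)->]; rewrite ?andbT ?andbF. Qed.

Lemma cell_surj i c s : 0 < i -> i < c -> i + c < 2 * n ->
  exists q, [/\ rowD q = i, colD q = c, sgnD q = sheet s c &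
    (q \in z) = (height z s c <= i)].
Proof.
move=> i0 ic icn; have [|q [qi qc qs]] := @coord_surj n i c (sheet s c) n1.
  by rewrite /valid_coord i0 ic icn /sheet; case: (c == n); rewrite ?andbF ?implybT.
by exists q; split=> //; rewrite mem_height qi qc qs height_sheet.
Qed.

Lemma mem_left i c s s' : 0 < i -> i < c -> i + c.+1 < 2 * n ->
  height z s c.+1 <= i -> height z s' c <= i.
Proof.
move=> i0 ic icn hi.
have [|//|q [qi qc qs qz]] := @cell_surj i c.+1 s i0; first lia.
have [|p [pi pc ps pz]] := @cell_surj i c s' i0 ic; first lia.
rewrite -pz; apply: (z_down (q := q)); last by rewrite qz.
rewrite le_coordE /coord_le pi qi pc qc leqnn leqnSn /=; apply/implyP; lia.
Qed.

Lemma height_height_fun s : height_fun n (height z s).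
Proof.
split=> [c cn|c c0 cn tc]; first exact: height_rng.
have hb := @height_rng s c.+1; have hb' := @height_rng s c.
have [tc'|tc'] := leqP c (height z s c.+1).
  by apply: leq_trans tc'; move: hb'; rewrite /bottom_row; lia.
by apply: mem_left (leqnn _) => //; move: hb; rewrite /bottom_row; lia.
Qed.

Variable r : nat.
Notation t := (height z).

Lemma height_bounds s c : 0 < c < 2 * n -> [/\ 0 < t s c, t s c <= c & t s c <= 2 * n - c].
Proof.
by move=> cn; have := height_rng s cn; rewrite /bottom_row leq_min => /and3P[].
Qed.

Lemma is_levelP q : (q \in [set p in z | rkD p == r]) =
  (rowD q == colD q - r.+1) && is_level n t r (sgnD q) (colD q).
Proof.
have [q0 q1 q2] := coord_bounds q; have := rk_row_col q.
rewrite inE mem_height /is_level /deep; lia.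
Qed.

(** Maximality is tested on the covers of a cell: the cell one row up, and the cell or, before
    column [n], the two cells to its right. *)
Lemma is_maxP q : (q \in max_above (@rkD n) r z) =
  (rowD q == t (sgnD q) (colD q)) && is_max n t r (sgnD q) (colD q).
Proof.
have [q0 q1 q2] := coord_bounds q; have rkq := rk_row_col q.
have [|t0 tc tn] := @height_bounds (sgnD q) (colD q); first lia.
apply/max_aboveP/andP.
  case; rewrite mem_height => qz rq qmax.
  have {}qz : rowD q = t (sgnD q) (colD q).
    apply/eqP; rewrite eqn_leq qz andbT leqNgt; apply/negP=> tq.
    have [|||p [pi pc ps pz]] := @cell_surj (rowD q).-1 (colD q) (sgnD q); try lia.
    have /negP[] : p \notin z.
      apply: qmax; rewrite lt_coordE le_coordE /coord_le pi pc ps /sheet.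
      by case: (boolP (sgnD q)) => [/sgn_col->|]; rewrite ?eqxx; lia.
    by rewrite pz; lia.
  split; first by rewrite qz.
  rewrite /is_max /deep /on_diag -qz; apply/andP; split; first lia.
  have [qd|qd] := eqVneq (rowD q + colD q).+1 (2 * n); first by rewrite andbT; lia.
  suff H s : rowD q < t s (colD q).+1 by rewrite !H.
  have [|||p [pi pc ps pz]] := @cell_surj (rowD q) (colD q).+1 s; try lia.
  have : p \notin z.
    apply: qmax; rewrite lt_coordE le_coordE /coord_le pi pc; lia.
  by rewrite pz; lia.
move=> [/eqP qi]; rewrite /is_max /deep -qi => /andP[dq up].
split; [by rewrite mem_height qi|by lia|move=> p]. 
rewrite lt_coordE => /andP[qp].
have := qp; rewrite le_coordE => /and3P[pi pc _] pq.
have [p0 p1 p2] := coord_bounds p; apply/negP=> pz.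
have [cE|cE] := eqVneq (colD p) (colD q).
  have sE := same_sheet qp (esym cE).
  by move: pz; rewrite mem_height cE -sE -qi; lia.
(* A diagonal cell has no right neighbour, so anything above it in another column is above the cell
   one row up. *)
have [pd|pd] := eqVneq (rowD q + colD q).+1 (2 * n).
  have [|||p' [pi' pc' ps' pz']] := @cell_surj (rowD q).-1 (colD q) (sgnD q); try lia.
  have : p' \in z.
    by apply: z_down pz; rewrite le_coordE /coord_le pi' pc'; lia.
  by rewrite pz'; lia.
have [|||p' [pi' pc' ps' pz']] := @cell_surj (rowD q) (colD q).+1 (sgnD p); try lia.
have : p' \in z.
  apply: z_down pz; rewrite le_coordE /coord_le pi' pc' ps' pi /sheet.
  case: (eqVneq (colD p) n) => [E|]; rewrite ?andbF ?andbT; last lia.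
  by case: (_ == n); rewrite ?andbT ?eqxx ?implybT; lia.
rewrite pz'; case/orP: up => [/andP[u1 u2]|]; last by rewrite /on_diag; lia.
by case: (sgnD p); lia.
Qed.

(** An element below [q] in another column lies below a left neighbour of [q], on a suitable
    sheet. *)
Lemma below_in_z q : (forall p, (p < q)%O -> colD p = colD q -> p \in z) ->
  (forall s, rowD q < (colD q).-1 -> t s (colD q).-1 <= rowD q) ->
  forall p, (p < q)%O -> p \in z.
Proof.
move=> same left p pq; have [q0 q1 q2] := coord_bounds q.
have [p0 p1 p2] := coord_bounds p.
have [cE|cE] := eqVneq (colD p) (colD q); first exact: same.
move: pq; rewrite lt_coordE le_coordE => /andP[/and3P[pi pc ps] pq].
have [|||p' [pi' pc' ps' pz']] := @cell_surj (rowD q) (colD q).-1 (sgnD p); try lia.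
have p'z : p' \in z by rewrite pz'; apply: left; lia.
apply: z_down p'z; rewrite le_coordE /coord_le pi' pc' ps' pi /sheet.
case: (eqVneq (colD p) n) => [E|]; rewrite ?andbF ?andbT /=; last lia.
by case: (_ == n); rewrite ?andbT ?eqxx ?implybT; lia.
Qed.

Lemma is_minP q : (q \in from_rank (@rkD n) r.+1 (min_compl z)) =
  (rowD q == (t (sgnD q) (colD q)).-1) && is_min t r (sgnD q) (colD q).
Proof.
have [q0 q1 q2] := coord_bounds q; have rkq := rk_row_col q.
have [|t0 tc tn] := @height_bounds (sgnD q) (colD q); first lia.
rewrite /from_rank inE; apply/andP/andP.
  case=> /min_complP[]; rewrite mem_height -ltnNge => qz qmin rq.
  have tq : t (sgnD q) (colD q) = (rowD q).+1.
    apply/eqP; rewrite eqn_leq qz andbT leqNgt; apply/negP=> tq.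
    have [|||p [pi pc ps pz]] := @cell_surj (rowD q).+1 (colD q) (sgnD q); try lia.
    have : p \in z.
      apply: qmin; rewrite lt_coordE le_coordE /coord_le pi pc ps /sheet.
      by case: (boolP (sgnD q)) => [/sgn_col->|]; rewrite ?eqxx; lia.
    by rewrite pz; lia.
  split; first by rewrite tq.
  rewrite /is_min /deep tq.
  suff H s : t s (colD q).-1 < (rowD q).+1 by rewrite !H; lia.
  have [|||p [pi pc ps pz]] := @cell_surj (rowD q) (colD q).-1 s; try lia.
  rewrite ltnS -pz; apply: qmin.
  by rewrite lt_coordE le_coordE /coord_le pi pc; lia.
case=> /eqP qi /and3P[]; rewrite /deep => dq l1 l2; split; last by lia.
apply/min_complP; split; first by rewrite mem_height; lia.
apply: below_in_z => [p pq cE|s _]; last by case: s; lia.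
rewrite mem_height (same_sheet (ltW pq) cE) cE.
by move: pq; rewrite lt_coordE le_coordE => /andP[/and3P[]]; lia.
Qed.

Lemma is_nextP q :
  (q \in [set p | (rkD p == r.+1) && [forall p', (p' < p)%O ==> (p' \in z)]]) =
  (rowD q == colD q - r.+2) && is_next n t r (sgnD q) (colD q).
Proof.
have [q0 q1 q2] := coord_bounds q; have rkq := rk_row_col q.
have [|t0 tc tn] := @height_bounds (sgnD q) (colD q); first lia.
rewrite inE; apply/andP/andP.
  case=> /eqP rq /forallP qmin.
  have {}qmin p : (p < q)%O -> p \in z by move/(_ p)/implyP: qmin.
  split; first lia.
  suff H s : t s (colD q).-1 <= rowD q.
    rewrite /is_next /deep; have H1 := H false; have H2 := H true.
    suff: t (sgnD q) (colD q) + r < colD q by lia.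
    have [qd|qd] := eqVneq (rowD q + colD q).+1 (2 * n); first lia.
    have [|||p [pi pc ps pz]] := @cell_surj (rowD q).+1 (colD q) (sgnD q); try lia.
    have : p \in z.
      apply: qmin; rewrite lt_coordE le_coordE /coord_le pi pc ps /sheet.
      by case: (boolP (sgnD q)) => [/sgn_col->|]; rewrite ?eqxx; lia.
    by rewrite pz; lia.
  have [|||p [pi pc ps pz]] := @cell_surj (rowD q) (colD q).-1 s; try lia.
  rewrite -pz; apply: qmin.
  by rewrite lt_coordE le_coordE /coord_le pi pc; lia.
case=> /eqP qi /and4P[]; rewrite /deep => dq l1 l2 l3; split; first by lia.
apply/forallP=> p; apply/implyP; move: p.
apply: below_in_z => [p pq cE|s _]; last by case: s; lia.
rewrite mem_height (same_sheet (ltW pq) cE) cE.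
by move: pq; rewrite lt_coordE le_coordE => /andP[/and3P[]]; lia.
Qed.

End ColumnHeights.

(** * The invariant *)

Section Invariant.
Variable n : nat.
Hypothesis n1 : 1 < n.
Implicit Types (p q x : PhiD n) (z X : {set PhiD n}) (s : bool) (i c r : nat).
Let rk := @rkD n.
Let rkP := @rk_lt n.

(** Heights determine a down-set and the sheets differ only in column [n], so this is stability
    under e_n <-> -e_n. *)
Definition swap_symmetric z : bool := height n1 z true n == height n1 z false n.

Definition low_rank r X : {set PhiD n} := [set q in X | rk q < r].

Definition level_open r z : {set PhiD n} :=
  [set q | (rk q == r) && [forall p, (p < q)%O ==> (p \in z)]].

Definition diag_count r X : nat :=
  #|[set q in from_rank rk r X | (rowD q + colD q).+1 == 2 * n]|.

Definition plus_mid_count r X : nat := #|[set q in from_rank rk r X | sgnD q]|.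

Definition hook_count r X : nat :=
  #|[set q in from_rank rk r X | ~~ sgnD q && hook n r (rowD q) (colD q)]|.

Lemma card_low_rankS r X :
  #|low_rank r.+1 X| = #|low_rank r X| + #|[set q in X | rk q == r]|.
Proof.
rewrite -(cardsID [set q in X | rk q == r] (low_rank r.+1 X)) addnC.
congr (_ + _); apply: eq_card => q; rewrite !inE ltnS; case: (q \in X) => //=.
  by rewrite ltn_neqAle.
by case: eqP => [->|]; rewrite ?andbF ?leqnn.
Qed.

Lemma card_level_open r z : downset z ->
  #|level_open r z| = #|[set q in min_compl z | rk q == r]| +
                      #|[set q in z | rk q == r]|.
Proof.
move=> z_down; rewrite -(cardsID z (level_open r z)) addnC.
congr (_ + _); apply: eq_card => q; rewrite !inE.
  by rewrite [RHS]andbAC andbA.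
rewrite andbC [RHS]andbC; case: eqP => //= qr; case: (boolP (q \in z)) => //= qz.
by apply/forallP=> p; apply/implyP=> pq; apply: z_down (ltW pq) qz.
Qed.

(** * Effect of one block on the terms of the invariant *)

Section Step.
Variables (r : nat) (X : {set PhiD n}).
Hypothesis aX : antichain X.
Let z := block_ideal rk r X.
Let Y := min_compl z.
Let t := height n1 z.

Let z_down : downset z. Proof. exact: (block_ideal_down rkP). Qed.

(** In these ranks the new set is the complement of the filter generated by [Y], and the minimal
    elements outside [z] generate its whole complement. *)
Lemma next_ideal_low q : rk q <= r -> (q \in block_ideal rk r.+1 Y) = (q \in z).
Proof.
move=> qr; rewrite inE ltnS qr; apply/exists_inPn/idP => [H|qz x /min_complP[xz _]].
  by apply/negPn/negP=> /(min_compl_ex rkP)[x xY xq]; have := H x xY; rewrite xq.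
by apply: contra xz => xq; apply: z_down xq qz.
Qed.

Lemma next_ideal_high q : r < rk q ->
  reflect (exists2 x, x \in from_rank rk r.+1 Y & (q <= x)%O)
          (q \in block_ideal rk r.+1 Y).
Proof.
move=> qr; rewrite inE ltnNge qr /=; apply: (iffP exists_inP) => -[x xY qx].
  by exists x => //; rewrite inE xY (leq_trans qr) // (rk_le rkP).
by exists x => //; move: xY; rewrite inE => /andP[].
Qed.

Lemma swap_step : swap_symmetric (block_ideal rk r.+1 Y) = swap_symmetric z.
Proof.
have z'_down : downset (block_ideal rk r.+1 Y).
  by apply: (block_ideal_down rkP); apply: min_compl_antichain.
set z' := block_ideal rk r.+1 Y in z'_down *; pose t' := height n1 z'.
have cell i s : 0 < i -> i < n -> exists q,
    [/\ rowD q = i, colD q = n, sgnD q = s,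
        (q \in z) = (t s n <= i) & (q \in z') = (t' s n <= i)].
  move=> i0 ci; have [//||q [qi qc qs qz]] := @cell_surj n n1 z z_down i n s i0; first lia.
  rewrite /sheet eqxx andbT in qs; exists q; split=> //.
  by rewrite (mem_height n1 z'_down) qi qc qs.
have rk_cell q : colD q = n -> rk q = n - rowD q - 1.
  by move=> qc; rewrite /rk rkE qc.
(* Equal heights make the generators in column [n] occur in mirror pairs; generators further right
   lie above both copies. *)
have sheet_le s : t s n = t (~~ s) n -> t' s n <= t' (~~ s) n.
  move=> ts; have /andP[i0 ib] := @height_rng n n1 z' (~~ s) n ltac:(lia).
  have /andP[_ ib'] := @height_rng n n1 z' s n ltac:(lia).
  have [iN|iN] := ltnP (t' (~~ s) n) n; last first.
    by apply: leq_trans iN; move: ib'; rewrite /bottom_row /t'; lia.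
  have [q [qi qc qs qz qz']] := cell _ (~~ s) i0 iN.
  have [p [pi pc ps pz pz']] := cell _ s i0 iN.
  rewrite -pz'; have {}qz' : q \in z' by rewrite qz'.
  have rkpq : rk p = rk q by rewrite !rk_cell // pi qi.
  have [qr|qr] := leqP (rk q) r.
    by rewrite next_ideal_low ?rkpq // pz ts -qz -next_ideal_low.
  have [x xY] := next_ideal_high qr qz'.
  rewrite le_coordE /coord_le qi qc qs eqxx => /and3P[xi xc xs].
  apply/next_ideal_high; first by rewrite rkpq.
  have [cn|cn] := eqVneq (colD x) n; last first.
    by exists x => //; rewrite le_coordE /coord_le pi pc xi xc (negPf cn) andbF.
  have sx : sgnD x = ~~ s by move: xs; rewrite cn eqxx => /eqP.
  have [x0 x1 x2] := coord_bounds x.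
  have [|y [yi yc ys _ _]] := cell (rowD x) s x0; first lia.
  exists y; last by rewrite le_coordE /coord_le pi pc ps yi yc ys xi leqnn !eqxx.
  move: xY; rewrite !(is_minP n1 z_down) yi yc ys sx cn -/t /is_min /deep -/t.
  by rewrite ts.
(* If the new heights agreed, the cells [q] and [p] in row [t (~~ s) n - 1], of which only [p] is in
   [z], would be both in or both out of the new ideal. This fails at once in ranks [<= r]; in higher
   ranks [q] is a generator, and [p] needs one too. *)
have asym s : t s n < t (~~ s) n -> t' s n != t' (~~ s) n.
  move=> ts; apply/eqP=> t'E.
  have a0 : 0 < t s n by have [] := height_bounds n1 z s (c := n) ltac:(lia).
  have bn : t (~~ s) n <= n by have [] := height_bounds n1 z (~~ s) (c := n) ltac:(lia).
  have b1 : 0 < (t (~~ s) n).-1 by clear -ts a0; lia.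
  have bn' : (t (~~ s) n).-1 < n by clear -n1 bn; lia.
  have [q [qi qc qs qz qz']] := cell _ (~~ s) b1 bn'.
  have [p [pi pc ps pz pz']] := cell _ s b1 bn'.
  (* A generator right of column [n] lies above the cell of its row on sheet [~~ s], which must
     therefore be in [z]. *)
  have right_above x : x \in from_rank rk r.+1 Y -> n < colD x ->
      t (~~ s) n <= rowD x.
    move=> xY xc; have [x0 x1 x2] := coord_bounds x.
    have xn : rowD x < n by clear -x2 xc; lia.
    have [y [yi yc ys yz _]] := cell (rowD x) (~~ s) x0 xn.
    rewrite -yz; move: xY; rewrite inE => /andP[/min_complP[_ xmin] _]; apply: xmin.
    rewrite lt_coordE le_coordE /coord_le yi yc leqnn (ltnW xc) (gtn_eqF xc).
    by rewrite (ltn_eqF xc) andbF orbT.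
  have rkpq : rk p = rk q by rewrite !rk_cell // pi qi.
  have [qr|qr] := leqP (rk q) r.
    have : q \notin z' by rewrite next_ideal_low // qz -ltnNge; clear -b1; lia.
    have : p \in z' by rewrite next_ideal_low ?rkpq // pz; clear -ts; lia.
    by rewrite pz' qz' t'E => ->.
  have qY : q \in from_rank rk r.+1 Y.
    rewrite (is_minP n1 z_down) qi qc qs eqxx /= /is_min /deep -/t.
    move: qr; rewrite rk_cell // qi => qr.
    suff H s' : t s' n.-1 <= t s n.
      by rewrite !(leq_ltn_trans (H _) ts) !andbT; clear -qr b1; lia.
    have tE s'' : t s'' n.-1 = t false n.-1 by rewrite /t height_eq //; clear -n1; lia.
    rewrite tE -(tE s).
    have [_ mono] := height_height_fun n1 z_down s.
    have := mono n.-1; rewrite (prednK (ltnW n1)) -/t => -> //; clear -n1; lia.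
  have {}pz' : p \in z'.
    rewrite pz' t'E -qz'; apply/next_ideal_high => //; by exists q.
  have pr : r < rk p by rewrite rkpq.
  have [x xY] := next_ideal_high pr pz'.
  rewrite le_coordE /coord_le pi pc ps eqxx => /and3P[xi xc xs].
  have [x0 x1 x2] := coord_bounds x.
  have xb : rowD x < t (~~ s) n by clear -xi b1; lia.
  have cn : colD x = n.
    apply/eqP; rewrite eqn_leq xc andbT leqNgt; apply/negP=> /(right_above x xY).
    by rewrite leqNgt xb.
  have sx : sgnD x = s by move: xs; rewrite cn eqxx => /eqP.
  have xrow : rowD x = (t s n).-1.
    by move: (xY); rewrite (is_minP n1 z_down) sx cn => /andP[/eqP].
  have xr : r < rk x by move: xY; rewrite inE => /andP[].
  have xn : rowD x < n by apply: leq_trans xb bn.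
  (* The mirror image [e] of [x] would need a generator in a row at or above its own, but the only
     candidate is in row [t (~~ s) n - 1], strictly below. *)
  have [e [ei ec es ez ez']] := cell (rowD x) (~~ s) x0 xn.
  have [x' [xi' xc' xs' xz' xz'']] := cell (rowD x) s x0 xn.
  have xz : x \in z' by apply/next_ideal_high => //; exists x.
  have xx' : x = x' by apply: coord_inj; congruence.
  have {}ez' : e \in z' by rewrite ez' -t'E -xz'' -xx'.
  have er : r < rk e by move: xr; rewrite !rk_cell // ei.
  have [y yY] := next_ideal_high er ez'.
  rewrite le_coordE /coord_le ei ec es eqxx => /and3P[yi yc ys].
  have ycn : colD y = n.
    apply/eqP; rewrite eqn_leq yc andbT leqNgt; apply/negP=> /(right_above y yY).
    by rewrite leqNgt (leq_ltn_trans yi xb).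
  have sy : sgnD y = ~~ s by move: ys; rewrite ycn eqxx => /eqP.
  have yrow : rowD y = (t (~~ s) n).-1.
    by move: (yY); rewrite (is_minP n1 z_down) sy ycn => /andP[/eqP].
  by move: yi; rewrite yrow xrow; clear -ts a0; lia.
rewrite /swap_symmetric -/t -/t'; have [E|E] := eqVneq (t true n) (t false n).
  by apply/eqP/anti_leq; rewrite (sheet_le true) // (sheet_le false).
apply/negbTE; move: E; rewrite neq_ltn => /orP[/(asym true)//|/(asym false)].
by rewrite eq_sym.
Qed.

(** [Y] keeps the elements of [X] of rank [< r] and acquires the minimal non-elements of rank [r],
    which [card_level_open] counts. *)
Lemma card_low_step :
  #|low_rank r.+1 Y| + #|[set q in z | rk q == r]| =
  #|low_rank r X| + #|level_open r z|.
Proof.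
have <- : [set q in Y | rk q < r] = low_rank r X.
  apply/setP=> q; rewrite in_set [RHS]in_set; case: ltnP => qr; rewrite ?andbF // !andbT.
  exact: (min_compl_block_low rkP aX qr).
rewrite card_low_rankS -addnA; congr (_ + _).
by rewrite -card_level_open.
Qed.

Lemma level_open_next : level_open r.+1 (block_ideal rk r.+1 Y) = level_open r.+1 z.
Proof.
apply/setP=> q; rewrite in_set [RHS]in_set; case: eqP => //= qr.
apply: eq_forallb => p; case: (boolP (p < q)%O) => //= pq.
by apply: next_ideal_low; rewrite -ltnS -qr; apply: rkP.
Qed.

Notation sum_col := (sum_columns n).

Let t_eq s (c : nat) : c != n -> t s c = t false c.
Proof. exact: height_eq. Qed.

Lemma is_max_valid s c : 0 < c < (2 * n).-1 -> s ==> (c == n) -> is_max n t r s c ->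
  valid_coord n (t s c) c s.
Proof.
move=> cn sc; have [|t0 tc tn] := height_bounds n1 z s (c := c); first by clear -cn; lia.
have [|_ tS tSn] := height_bounds n1 z false (c := c.+1); first by clear -cn; lia.
rewrite /is_max /valid_coord sc t0 /deep /on_diag /t => /andP[tr up].
by clear -tr up tSn tc tn; lia.
Qed.

Lemma is_min_valid s c : 0 < c < (2 * n).-1 -> s ==> (c == n) -> is_min t r s c ->
  valid_coord n (t s c).-1 c s.
Proof.
move=> cn sc; have [|t0 tc tn] := height_bounds n1 z s (c := c); first by clear -cn; lia.
have u0 : 1 < c -> 0 < height n1 z false c.-1.
  by move=> c1; have [] := height_bounds n1 z false (c := c.-1); first by clear -cn c1; lia.
rewrite /is_min /valid_coord sc /deep /t.
by clear -t0 tn tc u0; lia.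
Qed.

Lemma card_max : #|from_rank rk r X| = sum_col (is_max n t r).
Proof.
apply: (card_columns n1 (rho := t)) => [q|]; last exact: is_max_valid.
by rewrite (from_rank_block rkP) // (is_maxP n1 z_down).
Qed.

Lemma card_max_where (P : bool -> nat -> nat -> bool) :
  #|[set q in from_rank rk r X | P (sgnD q) (rowD q) (colD q)]| =
  sum_col (fun s c => is_max n t r s c && P s (t s c) c).
Proof.
apply: (card_columns n1 (rho := t)) => [q|s c cn sc /andP[]].
  rewrite in_set (from_rank_block rkP) // (is_maxP n1 z_down) -andbA.
  by case: eqP => //= ->.
by move=> mx _; apply: is_max_valid.
Qed.

Lemma card_min_where (P : bool -> nat -> nat -> bool) :
  #|[set q in from_rank rk r.+1 Y | P (sgnD q) (rowD q) (colD q)]| =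
  sum_col (fun s c => is_min t r s c && P s (t s c).-1 c).
Proof.
apply: (card_columns n1 (rho := fun s c => (t s c).-1)) => [q|s c cn sc /andP[]].
  by rewrite in_set (is_minP n1 z_down) -andbA; case: eqP => //= ->.
by move=> mn _; apply: is_min_valid.
Qed.

Lemma card_level : #|[set q in z | rk q == r]| = sum_col (is_level n t r).
Proof.
apply: (card_columns n1 (rho := fun _ c => c - r.+1)) => [q|s c cn sc].
  exact: is_levelP.
have [|t0 tc tn] := height_bounds n1 z s (c := c); first by clear -cn; lia.
by rewrite /is_level /deep /valid_coord sc /t; clear -t0 tc tn; lia.
Qed.

Lemma card_next : #|level_open r.+1 z| = sum_col (is_next n t r).
Proof.
apply: (card_columns n1 (rho := fun _ c => c - r.+2)) => [q|s c cn sc].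
  exact: is_nextP.
have [|t0 tc tn] := height_bounds n1 z s (c := c); first by clear -cn; lia.
have u0 : 1 < c -> 0 < height n1 z false c.-1.
  by move=> c1; have [] := height_bounds n1 z false (c := c.-1); first by clear -cn c1; lia.
by rewrite /is_next /deep /valid_coord sc /t; clear -t0 tc tn u0; lia.
Qed.

Lemma eq_sum_columns (F G : bool -> nat -> bool) :
  (forall s c, 0 < c < (2 * n).-1 -> F s c = G s c) -> sum_col F = sum_col G.
Proof.
move=> FG; rewrite /sum_columns FG; last by clear -n1; lia.
by congr (_ + _); apply: eq_big_nat => c cn; rewrite FG.
Qed.

Lemma diag_count_max : diag_count r X = sum_col (diag_max n t r).
Proof.
rewrite /diag_count (card_max_where (fun _ i c => (i + c).+1 == 2 * n)).
apply: eq_sum_columns => s c cn; rewrite /diag_max /is_max /on_diag /deep.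
by apply: andb_id2l => /andP[tr _]; clear -tr; lia.
Qed.

Lemma diag_count_min : diag_count r.+1 Y = sum_col (diag_min n t r).
Proof.
rewrite /diag_count (card_min_where (fun _ i c => (i + c).+1 == 2 * n)).
apply: eq_sum_columns => s c cn; rewrite /diag_min /is_min /over_diag /deep.
have [|t0 tc tn] := height_bounds n1 z s (c := c); first by clear -cn; lia.
by rewrite /t; apply: andb_id2l => /and3P[tr _ _]; clear -tr t0; lia.
Qed.

Lemma plus_mid_count_max : plus_mid_count r X = is_max n t r true n.
Proof.
rewrite /plus_mid_count (card_max_where (fun s _ _ => s)) /sum_columns andbT.
by rewrite big1 // => c _; rewrite andbF.
Qed.

Lemma plus_mid_count_min : plus_mid_count r.+1 Y = is_min t r true n.
Proof.
rewrite /plus_mid_count (card_min_where (fun s _ _ => s)) /sum_columns andbT.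
by rewrite big1 // => c _; rewrite andbF.
Qed.

Lemma hook_count_max : hook_count r X = sum_col (hook_max n t r).
Proof. exact: (card_max_where (fun s i c => ~~ s && hook n r i c)). Qed.

Lemma hook_count_min : hook_count r.+1 Y = sum_col (hook_min n t r).
Proof. exact: (card_min_where (fun s i c => ~~ s && hook n r.+1 i c)). Qed.

Lemma card_min : #|from_rank rk r.+1 Y| = sum_col (is_min t r).
Proof.
apply: (card_columns n1 (rho := fun s c => (t s c).-1)) => [q|]; last exact: is_min_valid.
exact: is_minP.
Qed.

Lemma balance_step :
  let sym := swap_symmetric z in
  #|level_open r.+1 z| + #|from_rank rk r X| + ~~ odd r * diag_count r.+1 Y +
    sym * plus_mid_count r.+1 Y + sym * hook_count r X =
  #|[set q in z | rk q == r]| + #|from_rank rk r.+1 Y| + odd r * diag_count r X +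
    sym * plus_mid_count r X + sym * hook_count r.+1 Y.
Proof.
rewrite /= card_next card_max card_level card_min diag_count_max diag_count_min.
rewrite plus_mid_count_max plus_mid_count_min hook_count_max hook_count_min.
have tf s := height_height_fun n1 z_down s.
rewrite /swap_symmetric -/t; case: eqP => [tE|/eqP].
  by rewrite !mul1n -(column_balance_sym n1 tf t_eq r tE).
rewrite !mul0n !addn0 neq_ltn => /orP[tE|tE].
  by rewrite -(column_balance_asym n1 tf t_eq r (s := false)) //.
by rewrite -(column_balance_asym n1 tf t_eq r (s := true)) //.
Qed.

End Step.
(** The corrected count, arranged without subtraction; [m] will be the size of the initial
    antichain, and [sym] is the same for all blocks. *)
Definition invariant m (sym : bool) r X : Prop :=
  let z := block_ideal rk r X in
  swap_symmetric z = sym /\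
  #|low_rank r X| + #|level_open r z| + odd r * diag_count r X +
    sym * plus_mid_count r X + m =
  n + #|from_rank rk r X| + sym * hook_count r X.

Lemma invariant_step m sym r X : antichain X -> invariant m sym r X ->
  invariant m sym r.+1 (min_compl (block_ideal rk r X)).
Proof.
move=> aX [symE E]; split; first by rewrite swap_step.
rewrite level_open_next //; have := balance_step r aX; have := card_low_step r aX.
rewrite /= symE -/(@rk); move: E; rewrite /=.
move: (diag_count _ _) (diag_count _ _) (hook_count _ _) (hook_count _ _) => d1 d2 h1 h2.
move: (plus_mid_count _ _) (plus_mid_count _ _) => p1 p2.
clear; case: sym; case: (odd r); rewrite /= ?mul1n ?mul0n; lia.
Qed.

Lemma card_simple : #|[set q | rk q == 0]| = n.
Proof.
rewrite (card_columns n1 (rho := fun _ c => c - 1) (phi := fun _ c => 1 < c <= n)).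
- rewrite /sum_columns n1 leqnn /= addn1.
  have H k : 0 < k <= n -> \sum_(1 <= c < k.+1) (1 < c <= n : nat) = k.-1.
    elim: k => // -[|k] IH /andP[_ kn]; first by rewrite big_nat1.
    by rewrite big_nat_recr //= IH ?kn ?(ltnW kn) //= addn1.
  rewrite (big_cat_nat (n := n.+1)) //=; [|by clear -n1; lia].
  rewrite H ?(ltnW n1) ?leqnn // [X in _ + X]big1_seq ?addn0; first by clear -n1; lia.
  move=> c /andP[_]; rewrite mem_index_iota => /andP[nc _].
  by rewrite [c <= n]leqNgt nc andbF.
- move=> q; rewrite in_set; have [q0 q1 q2] := coord_bounds q; have := rk_row_col n1 q.
  by rewrite -/rk; clear -q0 q1 q2; lia.
- by move=> s c cn sc cc; rewrite /valid_coord sc; clear -cn cc; lia.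
Qed.

(** The hook for [r = 0] is the copy [false] of column [n], so in the symmetric case its count
    equals that of the roots e_i + e_n and the two corrections cancel. *)
Lemma invariant0 X : antichain X ->
  exists sym, invariant #|X| sym 0 X.
Proof.
move=> aX; exists (swap_symmetric (block_ideal rk 0 X)); split=> //.
have -> : low_rank 0 X = set0 by apply/setP=> q; rewrite !inE andbF.
have -> : from_rank rk 0 X = X by apply/setP=> q; rewrite !inE andbT.
have -> : level_open 0 (block_ideal rk 0 X) = [set q | rk q == 0].
  apply/setP=> q; rewrite in_set [RHS]in_set; case: eqP => //= q0.
  by apply/forallP=> p; apply/implyP=> /rkP; rewrite -/rk q0.
rewrite cards0 card_simple mul0n add0n addn0 /swap_symmetric.
case: eqP => [E|_]; last by rewrite !mul0n !addn0.
rewrite !mul1n addnAC; congr (_ + _).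
rewrite plus_mid_count_max // hook_count_max // /sum_columns /hook_max andbF addn0.
have nn : 0 < n < (2 * n).-1 by clear -n1; lia.
have -> : is_max n (height n1 (block_ideal rk 0 X)) 0 true n =
    is_max n (height n1 (block_ideal rk 0 X)) 0 false n.
  by rewrite /is_max /deep /on_diag E.
rewrite -(sum_delta (fun c => is_max n _ 0 false c : nat) nn).
apply: eq_big_nat => c cn; rewrite /hook /= !addn0.
move: (height _ _) => t; rewrite /is_max /deep addn0.
have -> : (n <= c < n) = false by clear; lia.
case: eqVneq => [->|]; rewrite ?mul1n ?mul0n ?andbF ?orbF //=.
by case: (t false n < n); rewrite ?andbT ?andbF.
Qed.

End Invariant.

Theorem theorem6p1 (n : nat) (hn : 4 <= n) (A : {set PhiD n}) :
  antichain A -> #|A| + #|Rvac (@rkD n) A| = n.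
Proof.
move=> aA; have n1 : 1 < n by apply: leq_trans hn.
have [sym inv0] := invariant0 n1 aA.
have := Rvac_ind (@rk_lt n) aA inv0 (fun r Y => @invariant_step n n1 #|A| sym r Y).
set R := max_rank _; set B := Rvac _ _ => -[_].
(* Past the top rank every term but [low_rank] vanishes. *)
have rkR (q : PhiD n) : (R < rkD q) = false by rewrite ltnNge rk_max.
have -> : low_rank R.+1 B = B by apply/setP=> q; rewrite inE ltnS rk_max andbT.
have fr0 : from_rank (@rkD n) R.+1 B = set0.
  by apply/setP=> q; rewrite !inE rkR andbF.
have -> : level_open R.+1 (block_ideal (@rkD n) R.+1 B) = set0.
  by apply/setP=> q; rewrite !inE; case: eqP => //= rq; move: (rkR q); rewrite rq leqnn.
have sub0 (P : pred (PhiD n)) : #|[set q in set0 | P q]| = 0.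
  by apply/eqP; rewrite cards_eq0; apply/eqP/setP=> q; rewrite !inE.
rewrite /diag_count /plus_mid_count /hook_count fr0 !sub0 !cards0 !muln0 !addn0.
by rewrite addnC.
Qed.
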